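(* Let $t \in \mathbb{Z}_{\geq 1}$ and let $\mathcal{I}_{U_\infty}=i_{\infty+}(\mathcal{O}_{U_\infty})$ be the standard Harish-Chandra sheaf for $\mathcal{D}_t$ attached to the open $N$-orbit $U_\infty\subset X=\mathbb{CP}^1$. Then, as modules over $\mathfrak{g}=\mathfrak{sl}(2,\mathbb{C})$, \[ \Gamma(X,\mathcal{I}_{U_\infty})\simeq I(t-1), \] where $I(t-1)$ is the dual Verma module of highest weight $t-1$.
   Context: Let $\mathfrak{g}=\mathfrak{sl}(2,\mathbb{C})$ with standard basis $E=\begin{pmatrix}0&1\\0&0\end{pmatrix}$, $H=\begin{pmatrix}1&0\\0&-1\end{pmatrix}$, $F=\begin{pmatrix}0&0\\1&0\end{pmatrix}$, $\mathfrak{h}=\mathbb{C}H$, $\mathfrak{n}=\mathbb{C}E$, $\mathfrak{b}=\mathfrak{h}\oplus\mathfrak{n}$, $G=\mathrm{SL}(2,\mathbb{C})$, and $N\subset G$ the subgroup of upper triangular unipotent matrices. A weight $\mu\in\mathfrak{h}^*$ is identified with the number $\mu(H)$. Flag variety. $X=\mathbb{CP}^1$ with points $[x_0:x_1]$; $G$ acts by $\begin{pmatrix}a&b\\c&d\end{pmatrix}\cdot[x_0:x_1]=[ax_0+bx_1:cx_0+dx_1]$. Put $0=[1:0]$, $\infty=[0:1]$, $U_0=X\setminus\{\infty\}$ with coordinate $z=x_1/x_0$, $U_\infty=X\setminus\{0\}$ with coordinate $w=x_0/x_1$, and $V=U_0\cap U_\infty\simeq\mathbb{C}^\times$, on which $w=1/z$.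 The $N$-orbits on $X$ are $\{0\}$ and $U_\infty$. For $U$ affine open, $R(U)$ is its ring of regular functions and $D(U)$ its ring of differential operators. The sheaf $\mathcal{D}_t$. For $t\in\mathbb{Z}$, let $\mathcal{O}(t-1)$ be the line bundle whose sections over $U$ are homogeneous functions of degree $t-1$ on the preimage of $U$ in $\mathbb{C}^2\setminus\{0\}$, trivialized by $f\mapsto f(1,z)$ on $U_0$ and $f\mapsto f(w,1)$ on $U_\infty$ (so a section given by $q(w)$ on $U_\infty$ is given by $z^{t-1}q(1/z)$ on $U_0$). $\mathcal{D}_t$ is the sheaf of differential endomorphisms of $\mathcal{O}(t-1)$. The trivializations identify $\mathcal{D}_t|_{U_0}$ with $\mathcal{D}_{U_0}$ and $\mathcal{D}_t|_{U_\infty}$ with $\mathcal{D}_{U_\infty}$; over $V$ the two identifications differ by the ring automorphism $T\mapsto z^{t-1}Tz^{-(t-1)}$ of $D(V)$ (from the $U_\infty$ to the $U_0$ description). Differentiating the $G$-action $(g\cdot f)(x)=f(g^{-1}x)$ gives an algebra homomorphism $\mathcal{U}(\mathfrak{g})\to\Gamma(X,\mathcal{D}_t)$, under which $E,F,H$ map to the following operators. On $U_0$: $E_0=z^2\partial_z-z(t-1)$, $F_0=-\partial_z$, $H_0=2z\partial_z-(t-1)$. On $U_\infty$: $E_\infty=-\partial_w$, $F_\infty=w^2\partial_w-w(t-1)$, $H_\infty=-2w\partial_w+(t-1)$. Through this homomorphism the global sections of any $\mathcal{D}_t$-module form a $\mathfrak{g}$-module. The sheaf $\mathcal{I}_{U_\infty}$.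 Let $i_\infty:U_\infty\hookrightarrow X$ be the inclusion. $\mathcal{O}_{U_\infty}$ is a $\mathcal{D}_t|_{U_\infty}$-module via the identification $\mathcal{D}_t|_{U_\infty}=\mathcal{D}_{U_\infty}$ (so its sections over $U_\infty$ are $\mathbb{C}[w]$ with the usual action of $w$ and $\partial_w$), and $\mathcal{I}_{U_\infty}=i_{\infty+}(\mathcal{O}_{U_\infty})$ is its $\mathcal{D}_t$-module direct image; since $i_\infty$ is an open immersion of an affine subset, this is the sheaf-theoretic direct image with its induced $\mathcal{D}_t$-module structure. The Verma module is $M(\mu)=\mathcal{U}(\mathfrak{g})\otimes_{\mathcal{U}(\mathfrak{b})}\mathbb{C}_\mu$, where $H$ acts on $\mathbb{C}_\mu$ by $\mu$ and $E$ by $0$. The dual Verma module $I(\mu)$ is the contragredient dual of $M(\mu)$ in category $\mathcal{O}$: the direct sum of the duals of the ($H$-)weight spaces of $M(\mu)$, with $(x\cdot f)(m)=f(\sigma(x)m)$, where $\sigma$ is the anti-automorphism of $\mathfrak{g}$ exchanging $E$ and $F$ and fixing $H$. *)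

(* Defs.v *)
From HB Require Import structures.
From mathcomp Require Import all_boot all_order all_algebra.
From mathcomp Require Import generic_quotient complex ring.
From mathcomp Require Import all_classical all_reals all_analysis.
Import Order.TTheory GRing.Theory Num.Theory.
Import numFieldNormedType.Exports.

Set Implicit Arguments.
Unset Strict Implicit.
Unset Printing Implicit Defensive.

Local Open Scope classical_set_scope.
Local Open Scope ring_scope.

(* M with its scalars restricted along f. *)
Definition rscal (B A : pzRingType) (f : {rmorphism B -> A}) (M : lmodType A)
  : Type := M.

Section RestrictionOfScalars.
Variables (B A : pzRingType) (f : {rmorphism B -> A}) (M : lmodType A).

HB.instance Definition _ := GRing.Zmodule.on (rscal f M).

Definition rscal_scale (b : B) (m : rscal f M) : rscal f M := f b *: (m : M).

Fact rscal_scaleA a b v :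
  rscal_scale a (rscal_scale b v) = rscal_scale (a * b) v.
Proof. by rewrite /rscal_scale scalerA rmorphM. Qed.

Fact rscal_scale1 : left_id 1 rscal_scale.
Proof. by move=> v; rewrite /rscal_scale rmorph1 scale1r. Qed.

Fact rscal_scaleDr : right_distributive rscal_scale +%R.
Proof. by move=> a u v; rewrite /rscal_scale scalerDr. Qed.

Fact rscal_scaleDl v : {morph rscal_scale^~ v : a b / a + b}.
Proof. by move=> a b; rewrite /rscal_scale rmorphD scalerDl. Qed.

HB.instance Definition _ := GRing.Zmodule_isLmodule.Build B (rscal f M)
  rscal_scaleA rscal_scale1 rscal_scaleDr rscal_scaleDl.

End RestrictionOfScalars.

(* A \otimes_B Q, where A is a right B-module through j. *)
Section ExtensionOfScalars.
Variables (B A : pzRingType) (j : {rmorphism B -> A}) (Q : lmodType B).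

Inductive tterm : Type :=
| Tzero
| Ttens of A & Q
| Tadd of tterm & tterm
| Topp of tterm.

Inductive tterm_eq : tterm -> tterm -> Prop :=
| teq_refl x : tterm_eq x x
| teq_sym x y : tterm_eq x y -> tterm_eq y x
| teq_trans x y z : tterm_eq x y -> tterm_eq y z -> tterm_eq x z
| teq_add x x' y y' : tterm_eq x x' -> tterm_eq y y' ->
    tterm_eq (Tadd x y) (Tadd x' y')
| teq_opp x x' : tterm_eq x x' -> tterm_eq (Topp x) (Topp x')
| teq_addA x y z : tterm_eq (Tadd x (Tadd y z)) (Tadd (Tadd x y) z)
| teq_addC x y : tterm_eq (Tadd x y) (Tadd y x)
| teq_add0 x : tterm_eq (Tadd Tzero x) x
| teq_addN x : tterm_eq (Tadd (Topp x) x) Tzero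
| teq_tensDl a a' q : tterm_eq (Ttens (a + a') q) (Tadd (Ttens a q) (Ttens a' q))
| teq_tensDr a q q' : tterm_eq (Ttens a (q + q')) (Tadd (Ttens a q) (Ttens a q'))
| teq_balanced a b q : tterm_eq (Ttens (a * j b) q) (Ttens a (b *: q)).

HB.instance Definition _ := gen_eqMixin tterm.
HB.instance Definition _ := gen_choiceMixin tterm.

Definition tterm_rel : rel tterm := fun x y => `[< tterm_eq x y >].

Fact tterm_rel_refl : reflexive tterm_rel.
Proof. by move=> x; apply/asboolP; apply: teq_refl. Qed.
Fact tterm_rel_sym : symmetric tterm_rel.
Proof. by move=> x y; apply/asboolP/asboolP => h; apply: teq_sym. Qed.
Fact tterm_rel_trans : transitive tterm_rel.
Proof. by move=> y x z /asboolP h /asboolP k; apply/asboolP; apply: teq_trans h k. Qed.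

Canonical tterm_equiv :=
  EquivRel tterm_rel tterm_rel_refl tterm_rel_sym tterm_rel_trans.

Definition extscal : Type := {eq_quot tterm_equiv}%qT.
HB.instance Definition _ : EqQuotient _ tterm_equiv extscal :=
  EqQuotient.on extscal.
HB.instance Definition _ := Choice.on extscal.

Definition ext_pi : tterm -> extscal := \pi_extscal%qT.

Lemma ext_piP x y : ext_pi x = ext_pi y <-> tterm_eq x y.
Proof.
split=> [/eqmodP /asboolP //|h].
by apply/eqmodP/asboolP.
Qed.

Lemma ext_repr x : ext_pi (repr x) = x.
Proof. exact: reprK. Qed.

Lemma ext_reprE x : tterm_eq (repr (ext_pi x)) x.
Proof. by apply/ext_piP; rewrite ext_repr. Qed.

Definition ext_zero : extscal := ext_pi Tzero.
Definition ext_add (x y : extscal) : extscal := ext_pi (Tadd (repr x) (repr y)).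
Definition ext_opp (x : extscal) : extscal := ext_pi (Topp (repr x)).

Lemma ext_addE x y : ext_add (ext_pi x) (ext_pi y) = ext_pi (Tadd x y).
Proof. by apply/ext_piP/teq_add; apply: ext_reprE. Qed.
Lemma ext_oppE x : ext_opp (ext_pi x) = ext_pi (Topp x).
Proof. by apply/ext_piP/teq_opp; apply: ext_reprE. Qed.

Lemma ext_ind (P : extscal -> Prop) : (forall t, P (ext_pi t)) -> forall x, P x.
Proof. by move=> h x; rewrite -(ext_repr x). Qed.

Fact ext_addA : associative ext_add.
Proof.
elim/ext_ind=> x; elim/ext_ind=> y; elim/ext_ind=> z.
by rewrite !ext_addE; apply/ext_piP/teq_addA.
Qed.
Fact ext_addC : commutative ext_add.
Proof.
elim/ext_ind=> x; elim/ext_ind=> y.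
by rewrite !ext_addE; apply/ext_piP/teq_addC.
Qed.
Fact ext_add0 : left_id ext_zero ext_add.
Proof. by elim/ext_ind=> x; rewrite ext_addE; apply/ext_piP/teq_add0. Qed.
Fact ext_addN : left_inverse ext_zero ext_opp ext_add.
Proof. by elim/ext_ind=> x; rewrite ext_oppE ext_addE; apply/ext_piP/teq_addN. Qed.

HB.instance Definition _ := GRing.isZmodule.Build extscal
  ext_addA ext_addC ext_add0 ext_addN.

Definition tens (a : A) (q : Q) : extscal := ext_pi (Ttens a q).

Fixpoint tterm_scale (a : A) (t : tterm) : tterm :=
  match t with
  | Tzero => Tzero
  | Ttens b q => Ttens (a * b) q
  | Tadd x y => Tadd (tterm_scale a x) (tterm_scale a y)
  | Topp x => Topp (tterm_scale a x)
  end.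

Lemma tterm_scale_eq a x y :
  tterm_eq x y -> tterm_eq (tterm_scale a x) (tterm_scale a y).
Proof.
elim=> {x y} /=; try by [constructor | move=> *; constructor].
- by move=> x y z _ h _ k; apply: teq_trans h k.
- by move=> b b' q; rewrite mulrDr; constructor.
- by move=> b c q; rewrite mulrA; constructor.
Qed.

Definition ext_scale (a : A) (x : extscal) : extscal :=
  ext_pi (tterm_scale a (repr x)).

Lemma ext_scaleE a x : ext_scale a (ext_pi x) = ext_pi (tterm_scale a x).
Proof. by apply/ext_piP/tterm_scale_eq/ext_reprE. Qed.

Lemma ext_piD x y : ext_pi (Tadd x y) = ext_pi x + ext_pi y.
Proof. by rewrite -ext_addE. Qed.
Lemma ext_piN x : ext_pi (Topp x) = - ext_pi x.
Proof. by rewrite -ext_oppE. Qed.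

Fact ext_scaleA a b v : ext_scale a (ext_scale b v) = ext_scale (a * b) v.
Proof.
elim/ext_ind: v => t; rewrite !ext_scaleE; congr ext_pi.
by elim: t => //= [c q|x -> y ->|x ->] //; rewrite mulrA.
Qed.
Fact ext_scale1 : left_id 1 ext_scale.
Proof.
elim/ext_ind=> t; rewrite ext_scaleE; congr ext_pi.
by elim: t => //= [c q|x -> y ->|x ->] //; rewrite mul1r.
Qed.
Fact ext_scaleDr : right_distributive ext_scale +%R.
Proof.
move=> a; elim/ext_ind=> x; elim/ext_ind=> y.
by rewrite -ext_piD !ext_scaleE /= ext_piD.
Qed.
Fact ext_scaleDl v : {morph ext_scale^~ v : a b / a + b}.
Proof.
elim/ext_ind: v => t a b; rewrite !ext_scaleE.
elim: t => /= [|c q|x IHx y IHy|x IHx].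
- by rewrite -ext_piD; apply/ext_piP/teq_sym/teq_add0.
- by rewrite mulrDl -ext_piD; apply/ext_piP; constructor.
- by rewrite !ext_piD IHx IHy addrACA.
- by rewrite !ext_piN IHx opprD.
Qed.

HB.instance Definition _ := GRing.Zmodule_isLmodule.Build A extscal
  ext_scaleA ext_scale1 ext_scaleDr ext_scaleDl.

End ExtensionOfScalars.

Section Enveloping.
Variables (K : comPzRingType) (L : lmodType K) (br : L -> L -> L).

(* The associative unital K-algebra generated by the symbols Ugen x, x in L,
   subject to the relations ueq_genD, ueq_genZ and ueq_gen_br; the other
   relations are the axioms of a K-algebra. *)
Inductive uterm : Type :=
| Ucst of K
| Ugen of L
| Uadd of uterm & uterm
| Umul of uterm & uterm.

Inductive uterm_eq : uterm -> uterm -> Prop :=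
| ueq_refl x : uterm_eq x x
| ueq_sym x y : uterm_eq x y -> uterm_eq y x
| ueq_trans x y z : uterm_eq x y -> uterm_eq y z -> uterm_eq x z
| ueq_add x x' y y' : uterm_eq x x' -> uterm_eq y y' ->
    uterm_eq (Uadd x y) (Uadd x' y')
| ueq_mul x x' y y' : uterm_eq x x' -> uterm_eq y y' ->
    uterm_eq (Umul x y) (Umul x' y')
| ueq_addA x y z : uterm_eq (Uadd x (Uadd y z)) (Uadd (Uadd x y) z)
| ueq_addC x y : uterm_eq (Uadd x y) (Uadd y x)
| ueq_add0 x : uterm_eq (Uadd (Ucst 0) x) x
| ueq_mulA x y z : uterm_eq (Umul x (Umul y z)) (Umul (Umul x y) z)
| ueq_mul1l x : uterm_eq (Umul (Ucst 1) x) x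
| ueq_mul1r x : uterm_eq (Umul x (Ucst 1)) x
| ueq_mul0 x : uterm_eq (Umul (Ucst 0) x) (Ucst 0)
| ueq_mulDl x y z : uterm_eq (Umul (Uadd x y) z) (Uadd (Umul x z) (Umul y z))
| ueq_mulDr x y z : uterm_eq (Umul x (Uadd y z)) (Uadd (Umul x y) (Umul x z))
| ueq_cstD c d : uterm_eq (Ucst (c + d)) (Uadd (Ucst c) (Ucst d))
| ueq_cstM c d : uterm_eq (Ucst (c * d)) (Umul (Ucst c) (Ucst d))
| ueq_cst_comm c x : uterm_eq (Umul (Ucst c) x) (Umul x (Ucst c))
| ueq_genD x y : uterm_eq (Ugen (x + y)) (Uadd (Ugen x) (Ugen y))
| ueq_genZ c x : uterm_eq (Ugen (c *: x)) (Umul (Ucst c) (Ugen x))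
| ueq_gen_br x y : uterm_eq (Ugen (br x y))
    (Uadd (Umul (Ugen x) (Ugen y)) (Umul (Ucst (-1)) (Umul (Ugen y) (Ugen x)))).

HB.instance Definition _ := gen_eqMixin uterm.
HB.instance Definition _ := gen_choiceMixin uterm.

Definition uterm_rel : rel uterm := fun x y => `[< uterm_eq x y >].

Fact uterm_rel_refl : reflexive uterm_rel.
Proof. by move=> x; apply/asboolP; apply: ueq_refl. Qed.
Fact uterm_rel_sym : symmetric uterm_rel.
Proof. by move=> x y; apply/asboolP/asboolP => h; apply: ueq_sym. Qed.
Fact uterm_rel_trans : transitive uterm_rel.
Proof. by move=> y x z /asboolP h /asboolP k; apply/asboolP; apply: ueq_trans h k. Qed.

Canonical uterm_equiv :=
  EquivRel uterm_rel uterm_rel_refl uterm_rel_sym uterm_rel_trans.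

Definition envel : Type := {eq_quot uterm_equiv}%qT.
HB.instance Definition _ : EqQuotient _ uterm_equiv envel :=
  EqQuotient.on envel.
HB.instance Definition _ := Choice.on envel.

Definition env_pi : uterm -> envel := \pi_envel%qT.

Lemma env_piP x y : env_pi x = env_pi y <-> uterm_eq x y.
Proof.
split=> [/eqmodP /asboolP //|h].
by apply/eqmodP/asboolP.
Qed.

Lemma env_repr x : env_pi (repr x) = x.
Proof. exact: reprK. Qed.

Lemma env_reprE x : uterm_eq (repr (env_pi x)) x.
Proof. by apply/env_piP; rewrite env_repr. Qed.

Definition env_add (x y : envel) : envel := env_pi (Uadd (repr x) (repr y)).
Definition env_mul (x y : envel) : envel := env_pi (Umul (repr x) (repr y)).
Definition env_opp (x : envel) : envel := env_pi (Umul (Ucst (-1)) (repr x)).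

Lemma env_addE x y : env_add (env_pi x) (env_pi y) = env_pi (Uadd x y).
Proof. by apply/env_piP/ueq_add; apply: env_reprE. Qed.
Lemma env_mulE x y : env_mul (env_pi x) (env_pi y) = env_pi (Umul x y).
Proof. by apply/env_piP/ueq_mul; apply: env_reprE. Qed.
Lemma env_oppE x : env_opp (env_pi x) = env_pi (Umul (Ucst (-1)) x).
Proof. by apply/env_piP/ueq_mul; [apply: ueq_refl|apply: env_reprE]. Qed.

Lemma env_ind (P : envel -> Prop) : (forall t, P (env_pi t)) -> forall x, P x.
Proof. by move=> h x; rewrite -(env_repr x). Qed.

Fact env_addA : associative env_add.
Proof.
elim/env_ind=> x; elim/env_ind=> y; elim/env_ind=> z.
by rewrite !env_addE; apply/env_piP/ueq_addA.
Qed.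
Fact env_addC : commutative env_add.
Proof.
elim/env_ind=> x; elim/env_ind=> y.
by rewrite !env_addE; apply/env_piP/ueq_addC.
Qed.
Fact env_add0 : left_id (env_pi (Ucst 0)) env_add.
Proof. by elim/env_ind=> x; rewrite env_addE; apply/env_piP/ueq_add0. Qed.
Fact env_addN : left_inverse (env_pi (Ucst 0)) env_opp env_add.
Proof.
elim/env_ind=> x; rewrite env_oppE env_addE; apply/env_piP.
apply: ueq_trans (ueq_mul0 x); rewrite -[0](addNr 1).
apply: ueq_sym.
apply: ueq_trans (ueq_mul (ueq_cstD _ _) (ueq_refl x)) _.
apply: ueq_trans (ueq_mulDl _ _ _) _.
by apply: ueq_add; [apply: ueq_refl|apply: ueq_mul1l].
Qed.

HB.instance Definition _ := GRing.isZmodule.Build envel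
  env_addA env_addC env_add0 env_addN.

Fact env_mulA : associative env_mul.
Proof.
elim/env_ind=> x; elim/env_ind=> y; elim/env_ind=> z.
by rewrite !env_mulE; apply/env_piP/ueq_mulA.
Qed.
Fact env_mul1l : left_id (env_pi (Ucst 1)) env_mul.
Proof. by elim/env_ind=> x; rewrite env_mulE; apply/env_piP/ueq_mul1l. Qed.
Fact env_mul1r : right_id (env_pi (Ucst 1)) env_mul.
Proof. by elim/env_ind=> x; rewrite env_mulE; apply/env_piP/ueq_mul1r. Qed.
Fact env_mulDl : left_distributive env_mul env_add.
Proof.
elim/env_ind=> x; elim/env_ind=> y; elim/env_ind=> z.
by rewrite !(env_mulE, env_addE); apply/env_piP/ueq_mulDl.
Qed.
Fact env_mulDr : right_distributive env_mul env_add.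
Proof.
elim/env_ind=> x; elim/env_ind=> y; elim/env_ind=> z.
by rewrite !(env_mulE, env_addE); apply/env_piP/ueq_mulDr.
Qed.

HB.instance Definition _ := GRing.Zmodule_isPzRing.Build envel
  env_mulA env_mul1l env_mul1r env_mulDl env_mulDr.

Lemma env_piD x y : env_pi (Uadd x y) = env_pi x + env_pi y.
Proof. by rewrite -env_addE. Qed.
Lemma env_piM x y : env_pi (Umul x y) = env_pi x * env_pi y.
Proof. by rewrite -env_mulE. Qed.

Definition env_scalar (c : K) : envel := env_pi (Ucst c).
Definition env_gen (x : L) : envel := env_pi (Ugen x).

Lemma env_scalar0 : env_scalar 0 = 0. Proof. by []. Qed.

Fact env_scalar_nmod : nmod_morphism env_scalar.
Proof. by split=> // c d; rewrite /env_scalar -env_piD; apply/env_piP/ueq_cstD. Qed.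
Fact env_scalar_monoid : monoid_morphism env_scalar.
Proof. by split=> // c d; rewrite /env_scalar -env_piM; apply/env_piP/ueq_cstM. Qed.
HB.instance Definition _ := GRing.isNmodMorphism.Build K envel env_scalar
  env_scalar_nmod.
HB.instance Definition _ := GRing.isMonoidMorphism.Build K envel env_scalar
  env_scalar_monoid.

Lemma env_scalar_comm c x : env_scalar c * x = x * env_scalar c.
Proof.
elim/env_ind: x => x; rewrite -!env_piM.
by apply/env_piP/ueq_cst_comm.
Qed.

Lemma env_genD : {morph env_gen : x y / x + y}.
Proof. by move=> x y; rewrite /env_gen -env_piD; apply/env_piP/ueq_genD. Qed.
Lemma env_genZ c x : env_gen (c *: x) = env_scalar c * env_gen x.
Proof. by rewrite /env_gen -env_piM; apply/env_piP/ueq_genZ. Qed.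
Lemma env_gen_br x y :
  env_gen (br x y) = env_gen x * env_gen y - env_gen y * env_gen x.
Proof.
have -> : env_gen x * env_gen y - env_gen y * env_gen x =
  env_gen x * env_gen y + env_scalar (-1) * (env_gen y * env_gen x).
  by rewrite rmorphN rmorph1 mulNr mul1r.
by rewrite /env_gen -!env_piM -env_piD; apply/env_piP/ueq_gen_br.
Qed.

(* The extension to envel of a Lie algebra morphism f from L to an associative
   K-algebra A with structure map k. *)
Section Lift.
Variables (A : pzRingType) (k : {rmorphism K -> A}) (f : L -> A).
Hypothesis kC : forall c a, k c * a = a * k c.
Hypothesis fD : {morph f : x y / x + y}.
Hypothesis fZ : forall c x, f (c *: x) = k c * f x.
Hypothesis f_br : forall x y, f (br x y) = f x * f y - f y * f x.

Fixpoint uterm_eval (t : uterm) : A :=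
  match t with
  | Ucst c => k c
  | Ugen x => f x
  | Uadd x y => uterm_eval x + uterm_eval y
  | Umul x y => uterm_eval x * uterm_eval y
  end.

Lemma uterm_eval_eq x y : uterm_eq x y -> uterm_eval x = uterm_eval y.
Proof.
elim=> {x y} //=.
- by move=> x y z _ -> _ ->.
- by move=> x x' y y' _ -> _ ->.
- by move=> x x' y y' _ -> _ ->.
- by move=> x y z; rewrite addrA.
- by move=> x y; rewrite addrC.
- by move=> x; rewrite rmorph0 add0r.
- by move=> x y z; rewrite mulrA.
- by move=> x; rewrite rmorph1 mul1r.
- by move=> x; rewrite rmorph1 mulr1.
- by move=> x; rewrite rmorph0 mul0r.
- by move=> x y z; rewrite mulrDl.
- by move=> x y z; rewrite mulrDr.
- by move=> c d; rewrite rmorphD.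
- by move=> c d; rewrite rmorphM.
- by move=> x y; rewrite f_br rmorphN rmorph1 mulNr mul1r.
Qed.

Definition env_lift (u : envel) : A := uterm_eval (repr u).

Lemma env_liftE t : env_lift (env_pi t) = uterm_eval t.
Proof. exact/uterm_eval_eq/env_reprE. Qed.

Fact env_lift_nmod : nmod_morphism env_lift.
Proof.
split; first by rewrite [LHS]env_liftE /= rmorph0.
by elim/env_ind=> x; elim/env_ind=> y; rewrite -env_piD !env_liftE.
Qed.
Fact env_lift_monoid : monoid_morphism env_lift.
Proof.
split; first by rewrite [LHS]env_liftE /= rmorph1.
by elim/env_ind=> x; elim/env_ind=> y; rewrite -env_piM !env_liftE.
Qed.
HB.instance Definition _ := GRing.isNmodMorphism.Build envel A env_lift
  env_lift_nmod.
HB.instance Definition _ := GRing.isMonoidMorphism.Build envel A env_lift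
  env_lift_monoid.

Definition env_lift_morph : {rmorphism envel -> A} := env_lift.

End Lift.

End Enveloping.

Lemma ord2P (i : 'I_2) : i = 0 \/ i = 1.
Proof. by case: i => [[|[|//]]] i; [left|right]; apply/val_inj. Qed.

Section Sl2.
Variable K : fieldType.

Definition mxbr (A B : 'M[K]_2) : 'M[K]_2 := A *m B - B *m A.

Lemma mxtrace2 (A : 'M[K]_2) : \tr A = A 0 0 + A 1 1.
Proof. by rewrite /mxtrace big_ord_recl big_ord1; congr (A _ _ + A _ _); apply/val_inj. Qed.

Lemma mulmx2 m n (A : 'M[K]_(m, 2)) (B : 'M[K]_(2, n)) i j :
  (A *m B) i j = A i 0 * B 0 j + A i 1 * B 1 j.
Proof.
rewrite mxE big_ord_recl big_ord1.
by congr (_ + A _ _ * B _ _); apply/val_inj.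
Qed.

Definition sl2_pred : {pred 'M[K]_2} := fun A => \tr A == 0.
Definition borel_pred : {pred 'M[K]_2} := fun A => (\tr A == 0) && (A 1 0 == 0).

Fact sl2_submod : submod_closed sl2_pred.
Proof.
split; first by rewrite unfold_in mxtrace0.
move=> a A B; rewrite !unfold_in => /eqP hA /eqP hB.
by rewrite mxtraceD mxtraceZ hA hB mulr0 addr0.
Qed.
HB.instance Definition _ := GRing.isSubmodClosed.Build K 'M[K]_2 sl2_pred
  sl2_submod.

Fact borel_submod : submod_closed borel_pred.
Proof.
split; first by rewrite unfold_in mxtrace0 mxE !eqxx.
move=> a A B; rewrite !unfold_in => /andP[/eqP hA /eqP lA] /andP[/eqP hB /eqP lB].
by rewrite mxtraceD mxtraceZ hA hB mulr0 addr0 !mxE lA lB mulr0 addr0 !eqxx.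
Qed.
HB.instance Definition _ := GRing.isSubmodClosed.Build K 'M[K]_2 borel_pred
  borel_submod.

Record sl2 : Type := Sl2 { sl2_mx :> 'M[K]_2 ; _ : sl2_mx \in sl2_pred }.
HB.instance Definition _ := [isSub for sl2_mx].
HB.instance Definition _ := [Choice of sl2 by <:].
HB.instance Definition _ := [SubChoice_isSubLmodule of sl2 by <:].

Record borel : Type := Borel { borel_mx :> 'M[K]_2 ; _ : borel_mx \in borel_pred }.
HB.instance Definition _ := [isSub for borel_mx].
HB.instance Definition _ := [Choice of borel by <:].
HB.instance Definition _ := [SubChoice_isSubLmodule of borel by <:].

Fact sl2_br_subproof (A B : 'M[K]_2) : mxbr A B \in sl2_pred.
Proof. by rewrite unfold_in /mxbr raddfB /= mxtrace_mulC subrr. Qed.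
Definition sl2_br (A B : sl2) : sl2 := Sl2 (sl2_br_subproof A B).

Lemma borel_low (A : borel) : A 1 0 = 0.
Proof. by case: A => A /= /andP[_ /eqP]. Qed.

Fact borel_br_subproof (A B : borel) : mxbr A B \in borel_pred.
Proof.
rewrite unfold_in; apply/andP; split; first exact: (sl2_br_subproof A B).
rewrite /mxbr mxE [X in _ + X]mxE !mulmx2 !borel_low.
by rewrite !mul0r !mulr0 !addr0 subrr.
Qed.
Definition borel_br (A B : borel) : borel := Borel (borel_br_subproof A B).

Fact borel_sl2_subproof (A : borel) : (A : 'M[K]_2) \in sl2_pred.
Proof. by case: A => A /= /andP[]. Qed.
Definition borel_sl2 (A : borel) : sl2 := Sl2 (borel_sl2_subproof A).

Fact sl2_tr_subproof (A : sl2) : A^T \in sl2_pred.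
Proof. by rewrite unfold_in mxtrace_tr; case: A. Qed.
(* The anti-automorphism exchanging E and F and fixing H. *)
Definition sl2_tr (A : sl2) : sl2 := Sl2 (sl2_tr_subproof A).

Definition mxH : 'M[K]_2 := delta_mx 0 0 - delta_mx 1 1.

Fact sl2_H_subproof : mxH \in sl2_pred.
Proof. by rewrite unfold_in mxtrace2 !mxE /= subr0 sub0r subrr. Qed.
Definition sl2_H : sl2 := Sl2 sl2_H_subproof.
Fact sl2_E_subproof : (delta_mx 0 1 : 'M[K]_2) \in sl2_pred.
Proof. by rewrite unfold_in mxtrace2 !mxE /= addr0. Qed.
Definition sl2_E : sl2 := Sl2 sl2_E_subproof.
Fact sl2_F_subproof : (delta_mx 1 0 : 'M[K]_2) \in sl2_pred.
Proof. by rewrite unfold_in mxtrace2 !mxE /= addr0. Qed.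
Definition sl2_F : sl2 := Sl2 sl2_F_subproof.

Lemma mx2P (A B : 'M[K]_2) : A 0 0 = B 0 0 -> A 0 1 = B 0 1 ->
  A 1 0 = B 1 0 -> A 1 1 = B 1 1 -> A = B.
Proof.
move=> h1 h2 h3 h4; apply/matrixP => i j.
by case: (ord2P i) => ->; case: (ord2P j) => ->.
Qed.

Lemma sl2_decomp (A : sl2) :
  A = A 0 0 *: sl2_H + (A 0 1 *: sl2_E + A 1 0 *: sl2_F).
Proof.
apply/val_inj/mx2P; rewrite /= !mxE /= ?(mulr0, mulr1, addr0, add0r, subr0) //.
1,2: by rewrite oppr0 mulr0 add0r.
rewrite mulrN1; apply/eqP; rewrite -addr_eq0 addrC.
by case: A => A /=; rewrite unfold_in mxtrace2.
Qed.

Lemma sl2_brHE : sl2_br sl2_H sl2_E = 2%:R *: sl2_E.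
Proof.
apply/val_inj/mx2P; rewrite /= /mxbr [LHS]mxE [X in _ + X]mxE !mulmx2 !mxE /=; ring.
Qed.
Lemma sl2_brHF : sl2_br sl2_H sl2_F = - 2%:R *: sl2_F.
Proof.
apply/val_inj/mx2P; rewrite /= /mxbr [LHS]mxE [X in _ + X]mxE !mulmx2 !mxE /=; ring.
Qed.

Record gmod : Type := Gmod {
  gsort :> lmodType K ;
  gact : sl2 -> gsort -> gsort ;
  gactDl : forall x y m, gact (x + y) m = gact x m + gact y m ;
  gactZl : forall c x m, gact (c *: x) m = c *: gact x m ;
  gactDr : forall x m m', gact x (m + m') = gact x m + gact x m' ;
  gactZr : forall c x m, gact x (c *: m) = c *: gact x m ;
  gact_br : forall x y m,
    gact (sl2_br x y) m = gact x (gact y m) - gact y (gact x m)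
}.

Definition gmod_iso (M N : gmod) : Prop :=
  exists2 phi : {linear M -> N}, bijective phi &
    forall x m, phi (gact x m) = gact x (phi m).

(* A module over a K-algebra A (with structure map k) becomes a g-module through
   a Lie algebra morphism f : g -> A. *)
Section Pullback.
Variables (A : pzRingType) (k : {rmorphism K -> A}) (f : sl2 -> A).
Hypothesis kC : forall c a, k c * a = a * k c.
Hypothesis fD : {morph f : x y / x + y}.
Hypothesis fZ : forall c x, f (c *: x) = k c * f x.
Hypothesis f_br : forall x y, f (sl2_br x y) = f x * f y - f y * f x.
Variable M : lmodType A.

Definition pull_act (x : sl2) (m : rscal k M) : rscal k M := f x *: (m : M).

Fact pull_actDl x y m : pull_act (x + y) m = pull_act x m + pull_act y m.
Proof. by rewrite /pull_act fD scalerDl. Qed.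
Fact pull_actZl c x m : pull_act (c *: x) m = c *: pull_act x m.
Proof. by rewrite /pull_act fZ -scalerA. Qed.
Fact pull_actDr x m m' : pull_act x (m + m') = pull_act x m + pull_act x m'.
Proof. by rewrite /pull_act scalerDr. Qed.
Fact pull_actZr c x m : pull_act x (c *: m) = c *: pull_act x m.
Proof.
rewrite [RHS](_ : _ = k c *: (f x *: (m : M))) // scalerA kC -scalerA //.
Qed.
Fact pull_act_br x y m :
  pull_act (sl2_br x y) m = pull_act x (pull_act y m) - pull_act y (pull_act x m).
Proof. by rewrite /pull_act f_br scalerBl !scalerA. Qed.

Definition pullback : gmod :=
  Gmod pull_actDl pull_actZl pull_actDr pull_actZr pull_act_br.
End Pullback.

Definition Usl2 : pzRingType := envel sl2_br.
Definition Uborel : pzRingType := envel borel_br.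

Fact borel_sl2D : {morph (fun A => env_gen sl2_br (borel_sl2 A)) : A B / A + B}.
Proof. by move=> A B; rewrite -env_genD; congr env_gen; apply/val_inj. Qed.
Fact borel_sl2Z c A : env_gen sl2_br (borel_sl2 (c *: A)) =
  env_scalar sl2_br c * env_gen sl2_br (borel_sl2 A).
Proof. by rewrite -env_genZ; congr env_gen; apply/val_inj. Qed.
Fact borel_sl2_br A B : env_gen sl2_br (borel_sl2 (borel_br A B)) =
  env_gen sl2_br (borel_sl2 A) * env_gen sl2_br (borel_sl2 B)
  - env_gen sl2_br (borel_sl2 B) * env_gen sl2_br (borel_sl2 A).
Proof. by rewrite -env_gen_br; congr env_gen; apply/val_inj. Qed.

Definition Uincl : {rmorphism Uborel -> Usl2} :=
  env_lift_morph (@env_scalar_comm _ _ sl2_br) borel_sl2D borel_sl2Z borel_sl2_br.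

Section Verma.
Variable mu : K.

(* The character of b with H |-> mu and E |-> 0. *)
Definition borel_char (A : borel) : K := mu * A 0 0.

Fact borel_charC (c a : K) : idfun c * a = a * idfun c.
Proof. exact: mulrC. Qed.
Fact borel_charD : {morph borel_char : A B / A + B}.
Proof. by move=> A B; rewrite /borel_char mxE mulrDr. Qed.
Fact borel_charZ c A : borel_char (c *: A) = idfun c * borel_char A.
Proof. by rewrite /borel_char mxE mulrCA. Qed.
Fact borel_char_br A B : borel_char (borel_br A B) =
  borel_char A * borel_char B - borel_char B * borel_char A.
Proof.
rewrite /borel_char /= /mxbr mxE [X in _ + X]mxE !mulmx2 !borel_low.
by ring.
Qed.

Definition Uchar : {rmorphism Uborel -> K} :=
  env_lift_morph (k := idfun) borel_charC borel_charD borel_charZ borel_char_br.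

Definition Cmu : lmodType Uborel := rscal Uchar K^o.

Definition verma : gmod :=
  pullback (@env_scalar_comm _ _ sl2_br) (@env_genD _ _ sl2_br)
    (@env_genZ _ _ sl2_br) (@env_gen_br _ _ sl2_br) (extscal Uincl Cmu).

End Verma.

Section Contragredient.
Variable M : gmod.

Definition weight_space (la : K) : set M := [set m | gact sl2_H m = la *: m].

(* For M the direct sum of its weight spaces, the direct sum of the duals of the
   weight spaces consists of the linear forms on M that vanish on all but
   finitely many of them. *)
Definition cdual_pred : {pred M -> K^o} := fun f => `[<
  (forall c m m', f (c *: m + m') = c * f m + f m') /\
  exists s : seq K, forall la, la \notin s ->
    forall m, weight_space la m -> f m = 0 >].

Fact cdual_submod : submod_closed cdual_pred.
Proof.
split.
  apply/asboolP; split => [c m m'|]; first by rewrite mulr0 addr0.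
  by exists [::].
move=> a f g /asboolP[flin [s sP]] /asboolP[glin [s' sP']].
apply/asboolP; split=> [c m m'|].
  rewrite [LHS](_ : _ = a * f (c *: m + m') + g (c *: m + m')) //.
  rewrite [X in _ = c * X + _](_ : _ = a * f m + g m) //.
  rewrite [X in _ = _ + X](_ : _ = a * f m' + g m') //.
  by rewrite flin glin; ring.
exists (s ++ s') => la; rewrite mem_cat negb_or => /andP[h h'] m hm.
rewrite [LHS](_ : _ = a * f m + g m) //.
by rewrite (sP _ h _ hm) (sP' _ h' _ hm) mulr0 addr0.
Qed.
HB.instance Definition _ := GRing.isSubmodClosed.Build K (M -> K^o) cdual_pred
  cdual_submod.

Record cdual_sort : Type := CDual {
  cdual_fun :> M -> K^o ; _ : cdual_fun \in cdual_pred }.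
HB.instance Definition _ := [isSub for cdual_fun].
HB.instance Definition _ := [Choice of cdual_sort by <:].
HB.instance Definition _ := [SubChoice_isSubLmodule of cdual_sort by <:].

Lemma cdual_linear (f : cdual_sort) c m m' : f (c *: m + m') = c * f m + f m'.
Proof. by case: f => f /= /asboolP[]. Qed.
Lemma cdualD (f : cdual_sort) m m' : f (m + m') = f m + f m'.
Proof. by rewrite -[m]scale1r cdual_linear mul1r scale1r. Qed.
Lemma cdual0 (f : cdual_sort) : f 0 = 0.
Proof. by apply: (addrI (f 0)); rewrite -cdualD !addr0. Qed.
Lemma cdualZ (f : cdual_sort) c m : f (c *: m) = c * f m.
Proof. by rewrite -[c *: m]addr0 cdual_linear cdual0 addr0. Qed.
Lemma cdualB (f : cdual_sort) m m' : f (m - m') = f m - f m'.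
Proof. by rewrite -scaleN1r addrC cdual_linear mulN1r addrC. Qed.

Lemma weight_E la m : weight_space la m -> weight_space (la + 2%:R) (gact sl2_E m).
Proof.
rewrite /weight_space /= => h.
have := gact_br sl2_H sl2_E m; rewrite sl2_brHE gactZl h gactZr => /eqP.
by rewrite eq_sym subr_eq -scalerDl addrC => /eqP.
Qed.
Lemma weight_F la m : weight_space la m -> weight_space (la - 2%:R) (gact sl2_F m).
Proof.
rewrite /weight_space /= => h.
have := gact_br sl2_H sl2_F m; rewrite sl2_brHF gactZl h gactZr => /eqP.
by rewrite eq_sym subr_eq -scalerDl addrC => /eqP.
Qed.

Definition cdual_actf (x : sl2) (f : M -> K^o) : M -> K^o :=
  fun m => f (gact (sl2_tr x) m).

Fact cdual_act_subproof (x : sl2) (f : cdual_sort) :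
  cdual_actf x f \in cdual_pred.
Proof.
apply/asboolP; split=> [c m m'|].
  by rewrite /cdual_actf gactDr gactZr cdual_linear.
case: (f) (cdual_linear f) => g /= /asboolP[_ [s sP]] glin.
exists (s ++ map (fun la => la - 2%:R) s ++ map (fun la => la + 2%:R) s) => la.
rewrite !mem_cat !negb_or => /and3P[h1 h2 h3] m hm.
rewrite /cdual_actf (sl2_decomp (sl2_tr x)) !(gactDl, gactZl) hm.
have h2' : la + 2%:R \notin s.
  by apply: contra h2 => h2; apply/mapP; exists (la + 2%:R); rewrite ?addrK.
have h3' : la - 2%:R \notin s.
  by apply: contra h3 => h3; apply/mapP; exists (la - 2%:R); rewrite ?subrK.
rewrite scalerA glin (sP _ h1 _ hm) glin (sP _ h2' _ (weight_E hm)).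
rewrite -[_ *: gact sl2_F m]addr0 glin (sP _ h3' _ (weight_F hm)).
have g0 : g 0 = 0 by have := glin (-1) 0 0; rewrite scaler0 addr0 mulN1r addNr.
by rewrite g0 !mulr0 !addr0.
Qed.

Definition cdual_act (x : sl2) (f : cdual_sort) : cdual_sort :=
  CDual (cdual_act_subproof x f).

Fact cdual_actDl x y f : cdual_act (x + y) f = cdual_act x f + cdual_act y f.
Proof.
apply/val_inj/funext => m /=; rewrite [RHS](_ : _ = f (gact (sl2_tr x) m) + f (gact (sl2_tr y) m)) //.
rewrite /cdual_actf -cdualD -gactDl.
by congr (f (gact _ m)); apply/val_inj; rewrite /= linearD.
Qed.
Fact cdual_actZl c x f : cdual_act (c *: x) f = c *: cdual_act x f.
Proof.
apply/val_inj/funext => m /=; rewrite /cdual_actf.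
rewrite [RHS](_ : _ = c * f (gact (sl2_tr x) m)) // -cdualZ -gactZl.
by congr (f (gact _ m)); apply/val_inj; rewrite /= linearZ.
Qed.
Fact cdual_actDr x f g : cdual_act x (f + g) = cdual_act x f + cdual_act x g.
Proof. exact/val_inj. Qed.
Fact cdual_actZr c x f : cdual_act x (c *: f) = c *: cdual_act x f.
Proof. exact/val_inj. Qed.
Fact cdual_act_br x y f : cdual_act (sl2_br x y) f =
  cdual_act x (cdual_act y f) - cdual_act y (cdual_act x f).
Proof.
apply/val_inj/funext => m /=; rewrite [RHS](_ : _ = f (gact (sl2_tr y) (gact (sl2_tr x) m)) -
  f (gact (sl2_tr x) (gact (sl2_tr y) m))) //.
rewrite /cdual_actf -cdualB -gact_br.
congr (f (gact _ m)); apply/val_inj => /=.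
by rewrite /mxbr linearB /= !trmx_mul.
Qed.

Definition cdual : gmod :=
  Gmod cdual_actDl cdual_actZl cdual_actDr cdual_actZr cdual_act_br.

End Contragredient.

Definition dual_verma (mu : K) : gmod := cdual (verma mu).

End Sl2.

Section ProjectiveLine.
Variable K : numClosedFieldType.
Local Notation V := 'cV[K]_2.

Inductive polyfun : (V -> K) -> Prop :=
| polyfun_cst c : polyfun (fun=> c)
| polyfun_coord i : polyfun (fun v => v i 0)
| polyfun_add p q : polyfun p -> polyfun q -> polyfun (fun v => p v + q v)
| polyfun_mul p q : polyfun p -> polyfun q -> polyfun (fun v => p v * q v).

(* f is regular on A: locally on A, for the Zariski topology, it is a quotient
   of polynomials. *)
Definition regular_on (A : set V) (f : V -> K) : Prop :=
  forall v, A v -> exists p q, [/\ polyfun p, polyfun q, q v != 0 &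
    forall u, A u -> q u != 0 -> f u = p u / q u].

(* Points of CP^1 are the lines of K^2; <[v]>%VS is the point [v 0 0 : v 1 0]. *)
Definition P1 : Type := {L : {vspace V} | \dim L == 1%N}.

Definition cone (U : set P1) : set V :=
  [set v | exists2 L : P1, U L & \val L = <[v]>%VS].

(* The quotient topology of the Zariski topology of K^2 minus 0. *)
Definition zopen (U : set P1) : Prop :=
  forall v, cone U v -> exists p, [/\ polyfun p, p v != 0 &
    forall u, u != 0 -> p u != 0 -> cone U u].

Record opn : Type := Opn { oset :> set P1 ; opnP : zopen oset }.

Lemma cone_neq0 U v : cone U v -> v != 0.
Proof.
move=> [[L hL] _ /= LE]; apply/eqP => v0.
by move: hL; rewrite LE v0 dim_vline eqxx.
Qed.

Lemma coneP U v (v0 : \dim <[v]>%VS == 1%N) : cone U v <-> U (Sub <[v]>%VS v0).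
Proof.
split=> [[L UL LE]|h]; last by exists (Sub <[v]>%VS v0); rewrite ?SubK.
by rewrite (_ : Sub _ _ = L) //; apply/val_inj; rewrite LE SubK.
Qed.

Lemma vline_scale (c : K) (v : V) : c != 0 -> <[c *: v]>%VS = <[v]>%VS.
Proof.
move=> c0; apply/vspaceP => w; apply/vlineP/vlineP => -[k ->].
  by exists (k * c); rewrite scalerA.
by exists (k / c); rewrite scalerA divfK.
Qed.

Lemma cone_scale U c v : c != 0 -> cone U (c *: v) <-> cone U v.
Proof.
by move=> c0; split=> -[L UL LE]; exists L => //; rewrite LE vline_scale.
Qed.

Lemma cone_sub (U W : set P1) : W `<=` U -> cone W `<=` cone U.
Proof. by move=> h v [L /h UL LE]; exists L. Qed.

Lemma cone_inj (L : P1) : exists v, \val L = <[v]>%VS.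
Proof.
case: L => L hL; exists (vpick L); rewrite /=; apply/esym/eqP.
rewrite eqEdim -memvE memv_pick (eqP hL) dim_vline.
by rewrite vpick0 -dimv_eq0 (eqP hL).
Qed.

Lemma cone_subP (U W : set P1) : cone W `<=` cone U -> W `<=` U.
Proof.
move=> h L WL; have [v LE] := cone_inj L.
have [L' UL' LE'] : cone U v by apply: h; exists L.
by rewrite (_ : L = L') //; apply/val_inj; rewrite LE LE'.
Qed.

Lemma coneI U W v : cone (U `&` W) v <-> cone U v /\ cone W v.
Proof.
split=> [[L [UL WL] LE]|[[L UL LE] [L' WL' LE']]].
  by split; exists L.
exists L => //; split=> //; rewrite (_ : L = L') //.
by apply/val_inj; rewrite LE LE'.
Qed.

Lemma coneT v : cone setT v <-> v != 0.
Proof.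
split=> [/cone_neq0 //|v0].
have h : \dim <[v]>%VS == 1%N by rewrite dim_vline v0.
by exists (Sub <[v]>%VS h); rewrite ?SubK.
Qed.

Lemma vec0P (v : V) : v != 0 -> exists i, v i 0 != 0.
Proof.
move=> v0; apply: contrapT => h; case/eqP: v0.
apply/matrixP => i j; rewrite (ord1 j) mxE; apply/eqP/negPn/negP => vi.
by apply: h; exists i.
Qed.

Fact zopenT : zopen setT.
Proof.
move=> v /cone_neq0 v0; have [i vi] := vec0P v0.
by exists (fun v => v i 0); split; [constructor|exact: vi|move=> u u0 _; apply/coneT].
Qed.
Definition opnT : opn := Opn zopenT.

Fact zopenI (U W : opn) : zopen (U `&` W).
Proof.
move=> v /coneI[/(opnP (o := U))[p [pp pv pU]] /(opnP (o := W))[q [qp qv qW]]].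
exists (fun v => p v * q v); split; first by constructor.
  exact: mulf_neq0.
move=> u u0; rewrite mulf_eq0 negb_or => /andP[pu qu].
by apply/coneI; split; [apply: pU|apply: qW].
Qed.
Definition opnI (U W : opn) : opn := Opn (@zopenI U W).

Lemma regular_sub (A B : set V) f g : regular_on A f -> B `<=` A ->
  (forall v, B v -> g v = f v) -> regular_on B g.
Proof.
move=> freg BA fg v /[dup] Bv /BA/freg[p [q [pp qp qv E]]].
by exists p, q; split=> // u Bu qu; rewrite fg // E //; apply: BA.
Qed.

Lemma regular_cst (A : set V) c : regular_on A (fun=> c).
Proof.
move=> v _; exists (fun=> c), (fun=> 1); split; try by constructor.
  exact: oner_neq0.
by move=> u _ _; rewrite divr1.
Qed.

Lemma regular_mul (A : set V) f g : regular_on A f -> regular_on A g ->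
  regular_on A (fun v => f v * g v).
Proof.
move=> freg greg v Av; have [p [q [pp qp qv E]]] := freg v Av.
have [p' [q' [pp' qp' qv' E']]] := greg v Av.
exists (fun v => p v * p' v), (fun v => q v * q' v); split; try by constructor.
  exact: mulf_neq0.
move=> u Au; rewrite mulf_eq0 negb_or => /andP[qu qu'].
by rewrite E // E' // mulf_div.
Qed.

Lemma regular_add (A : set V) f g : regular_on A f -> regular_on A g ->
  regular_on A (fun v => f v + g v).
Proof.
move=> freg greg v Av; have [p [q [pp qp qv E]]] := freg v Av.
have [p' [q' [pp' qp' qv' E']]] := greg v Av.
exists (fun v => p v * q' v + p' v * q v), (fun v => q v * q' v); split.
- by do !constructor.
- by constructor.
- exact: mulf_neq0.
move=> u Au; rewrite mulf_eq0 negb_or => /andP[qu qu'].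
by rewrite E // E' // addf_div.
Qed.

Lemma polyfun_exp p k : polyfun p -> polyfun (fun v => p v ^+ k).
Proof.
move=> pp; elim: k => [|k IHk].
  by rewrite (_ : (fun _ => _) = fun=> 1); [constructor|apply/funext => v; rewrite expr0].
rewrite (_ : (fun _ => _) = fun v => p v * p v ^+ k); first by constructor.
by apply/funext => v; rewrite exprS.
Qed.

Lemma regular_expz (A : set V) p (n : int) : polyfun p ->
  (forall v, A v -> p v != 0) -> regular_on A (fun v => p v ^ n).
Proof.
move=> pp pA v Av; case: n => k.
  exists (fun v => p v ^+ k), (fun=> 1); split; try by constructor.
  - exact: polyfun_exp.
  - exact: oner_neq0.
  - by move=> u _ _; rewrite divr1.
exists (fun=> 1), (fun v => p v ^+ k.+1); split.
- by constructor.
- exact: polyfun_exp.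
- by rewrite expf_neq0 // pA.
- by move=> u _ _; rewrite NegzE -exprnN div1r.
Qed.

Lemma polyfun_diff p v : polyfun p -> differentiable (p : V -> K^o) v.
Proof.
elim=> [c|i|f g _ df _ dg|f g _ df _ dg].
- exact: differentiable_cst.
- exact: differentiable_coord.
- exact: (@differentiableD _ _ _ (f : V -> K^o) (g : V -> K^o)).
- exact: (@differentiableM _ _ (f : V -> K^o) (g : V -> K^o)).
Qed.

Lemma polyfun_near p v : polyfun p -> p v != 0 -> \near v, p v != 0.
Proof.
move=> pp pv.
have /differentiable_continuous c : differentiable (p : V -> K^o) v.
  exact: polyfun_diff.
have := @cvgr_neq0 _ _ _ _ _ (p : V -> K^o) _ c pv.
exact.
Qed.

Lemma cone_near (U : opn) v : cone U v -> \near v, cone U v.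
Proof.
move=> Uv; have [p [pp pv pU]] := opnP Uv.
have [i vi] := vec0P (cone_neq0 Uv).
have h1 := polyfun_near pp pv.
have h2 := polyfun_near (polyfun_coord i) vi.
near=> u; apply: pU; last by near: u.
have : u i 0 != 0 by near: u.
by apply: contra => /eqP ->; rewrite mxE.
Unshelve. all: by end_near. Qed.

Lemma deriveD_poly p q v w : polyfun p -> polyfun q ->
  'D_w (fun u => p u + q u : K^o) v = 'D_w (p : V -> K^o) v + 'D_w (q : V -> K^o) v.
Proof.
move=> pp qp.
by rewrite (@deriveD _ _ _ (p : V -> K^o) (q : V -> K^o)) //;
  apply/diff_derivable/polyfun_diff.
Qed.

Lemma deriveM_poly p q v w : polyfun p -> polyfun q ->
  'D_w (fun u => p u * q u : K^o) v =
  p v * 'D_w (q : V -> K^o) v + q v * 'D_w (p : V -> K^o) v.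
Proof.
move=> pp qp.
by rewrite (@deriveM _ _ (p : V -> K^o) (q : V -> K^o)) //;
  apply/diff_derivable/polyfun_diff.
Qed.

Lemma derive_coord i v w : 'D_w (fun u : V => u i 0 : K^o) v = w i 0.
Proof.
rewrite deriveE; last exact: differentiable_coord.
have @f : {linear V -> K^o}.
  by exists (fun N : V => N i 0); do 2![eexists]; do ?[constructor];
     rewrite ?mxE// => ? *; rewrite ?mxE//; move=> ?; rewrite !mxE.
rewrite (_ : (fun _ => _) = f) // diff_lin //.
exact: coord_continuous.
Qed.

Lemma derive_quot (U : opn) (f p q : V -> K) v w :
  polyfun p -> polyfun q -> cone U v -> q v != 0 ->
  (forall u, cone U u -> q u != 0 -> f u = p u / q u) ->
  'D_w (f : V -> K^o) v =
    ('D_w (p : V -> K^o) v * q v - p v * 'D_w (q : V -> K^o) v) / q v ^+ 2.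
Proof.
move=> pp qp Uv qv E.
have h1 := cone_near Uv; have h2 := polyfun_near qp qv.
have -> : 'D_w (f : V -> K^o) v = 'D_w (fun u => p u * (q u)^-1 : K^o) v.
  by apply: near_eq_derive; near=> u; apply: E; near: u.
have dp : derivable (p : V -> K^o) v w by apply/diff_derivable/polyfun_diff.
have dq : derivable (q : V -> K^o) v w by apply/diff_derivable/polyfun_diff.
rewrite (@deriveM _ _ (p : V -> K^o) (fun u => (q u)^-1 : K^o)) //; last first.
  exact: (@derivableV _ _ (q : V -> K^o)).
rewrite (@deriveV _ _ (q : V -> K^o)) // /GRing.scale /=.
by field.
Unshelve. all: by end_near. Qed.

Lemma regular_derivable (U : opn) f v w : regular_on (cone U) f -> cone U v ->
  derivable (f : V -> K^o) v w.
Proof.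
move=> freg Uv; have [p [q [pp qp qv E]]] := freg v Uv.
have h1 := cone_near Uv; have h2 := polyfun_near qp qv.
apply: (@near_eq_derivable _ _ _ (fun u => p u * (q u)^-1 : K^o)).
  by near=> u; apply/esym/E; near: u.
have dp : derivable (p : V -> K^o) v w by apply/diff_derivable/polyfun_diff.
have dq : derivable (q : V -> K^o) v w by apply/diff_derivable/polyfun_diff.
apply: (@derivableM _ _ (p : V -> K^o) (fun u => (q u)^-1 : K^o)) => //.
exact: (@derivableV _ _ (q : V -> K^o)).
Unshelve. all: by end_near. Qed.

Section LieDerivative.
Variable xi : 'M[K]_2.

(* d/ds at s = 0 of f (exp(- s xi) v): the action of xi obtained by
   differentiating (g . f)(v) = f (g^-1 v). *)
Definition lie_derive (f : V -> K) (v : V) : K :=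
  'D_(- (xi *m v)) (f : V -> K^o) v.

Lemma polyfun_lie p : polyfun p -> polyfun (lie_derive p).
Proof.
elim=> [c|i|f g pf df pg dg|f g pf df pg dg].
- rewrite (_ : lie_derive _ = fun=> 0); first by constructor.
  by apply/funext => v; rewrite /lie_derive (@derive_cst _ _ K^o).
- rewrite (_ : lie_derive _ = fun v => (- xi i 0) * v 0 0 + (- xi i 1) * v 1 0).
    by do !constructor.
  apply/funext => v; rewrite /lie_derive derive_coord mxE mulmx2.
  by rewrite opprD !mulNr.
- rewrite (_ : lie_derive _ = fun v => lie_derive f v + lie_derive g v).
    by constructor.
  by apply/funext => v; rewrite /lie_derive deriveD_poly.
- rewrite (_ : lie_derive _ = fun v => f v * lie_derive g v + g v * lie_derive f v).
    by do !constructor.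
  by apply/funext => v; rewrite /lie_derive deriveM_poly.
Qed.

Lemma lie_derive_quot (U : opn) (f p q : V -> K) v :
  polyfun p -> polyfun q -> cone U v -> q v != 0 ->
  (forall u, cone U u -> q u != 0 -> f u = p u / q u) ->
  lie_derive f v = (lie_derive p v * q v - p v * lie_derive q v) / q v ^+ 2.
Proof. by move=> pp qp Uv qv E; rewrite /lie_derive (derive_quot _ pp qp Uv qv E). Qed.

Lemma regular_lie (U : opn) f :
  regular_on (cone U) f -> regular_on (cone U) (lie_derive f).
Proof.
move=> freg v Uv; have [p [q [pp qp qv E]]] := freg v Uv.
exists (fun v => lie_derive p v * q v + (-1) * (p v * lie_derive q v)),
  (fun v => q v ^+ 2); split.
- have plp := polyfun_lie pp; have plq := polyfun_lie qp.
  by do !constructor.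
- exact: polyfun_exp.
- by rewrite expf_neq0.
- move=> u Uu; rewrite expf_eq0 /= => qu; rewrite (lie_derive_quot pp qp Uu qu E).
  by rewrite mulN1r.
Qed.

Lemma lie_derive_homog (U : opn) f (n : int) c v : regular_on (cone U) f ->
  cone U v -> c != 0 -> (forall u, f (c *: u) = c ^ n * f u) ->
  lie_derive f (c *: v) = c ^ n * lie_derive f v.
Proof.
move=> freg Uv c0 fh; rewrite /lie_derive.
rewrite -scalemxAr -scalerN; set w := - _.
have df : derivable (f : V -> K^o) v w by exact: (regular_derivable freg Uv).
rewrite -[RHS](@deriveZ _ _ _ (f : V -> K^o)) //.
rewrite /derive [X in lim (X @ _)](_ : _ = (fun h => h^-1 *: (((c ^ n \*: (f : V -> K^o)) \o shift v) (h *: w) - (c ^ n \*: (f : V -> K^o)) v))); last first.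
  apply/funext => h /=.
  by rewrite scalerA [h * c]mulrC -scalerA -scalerDr !fh.
by [].
Qed.

Lemma lie_deriveM (U : opn) f g v : regular_on (cone U) f ->
  regular_on (cone U) g -> cone U v ->
  lie_derive (fun u => f u * g u) v = f v * lie_derive g v + g v * lie_derive f v.
Proof.
move=> freg greg Uv.
exact: (@deriveM _ _ (f : V -> K^o) (g : V -> K^o) _ _
  (regular_derivable freg Uv) (regular_derivable greg Uv)).
Qed.

Lemma lie_deriveD (U : opn) f g v : regular_on (cone U) f ->
  regular_on (cone U) g -> cone U v ->
  lie_derive (fun u => f u + g u) v = lie_derive f v + lie_derive g v.
Proof.
move=> freg greg Uv.
exact: (@deriveD _ _ _ (f : V -> K^o) (g : V -> K^o) _ _
  (regular_derivable freg Uv) (regular_derivable greg Uv)).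
Qed.

Lemma lie_derive_local (U : opn) f g v : cone U v ->
  (forall u, cone U u -> f u = g u) -> lie_derive f v = lie_derive g v.
Proof.
move=> Uv fg; apply: near_eq_derive.
have h := cone_near Uv; near=> u; apply: fg; near: u; exact: h.
Unshelve. all: by end_near. Qed.

End LieDerivative.

Lemma lie_derive_poly_linear (xi eta : 'M[K]_2) c p v : polyfun p ->
  lie_derive (c *: xi + eta) p v = c * lie_derive xi p v + lie_derive eta p v.
Proof.
move=> pp; rewrite /lie_derive !deriveE ?(polyfun_diff _ pp) //;
  try exact: polyfun_diff.
by rewrite mulmxDl -scalemxAl opprD -scalerN linearD linearZ.
Qed.

Lemma lie_derive_linear (U : opn) (xi eta : 'M[K]_2) c f v :
  regular_on (cone U) f -> cone U v ->
  lie_derive (c *: xi + eta) f v = c * lie_derive xi f v + lie_derive eta f v.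
Proof.
move=> freg Uv; have [p [q [pp qp qv E]]] := freg v Uv.
rewrite !(lie_derive_quot _ pp qp Uv qv E) !lie_derive_poly_linear //.
by field.
Qed.

Local Ltac gen_lie := repeat match goal with
  |- context [lie_derive ?x ?p ?v] => generalize (lie_derive x p v); intro end.

Local Ltac pf := repeat match goal with
  | |- polyfun (fun v => fun_of_matrix v _ _) => apply polyfun_coord
  | |- polyfun _ => assumption
  | |- polyfun (fun _ => ?c) => apply (polyfun_cst c)
  | |- polyfun (fun v => @?f v + @?g v) => apply (@polyfun_add f g)
  | |- polyfun (fun v => @?f v * @?g v) => apply (@polyfun_mul f g)
  | |- polyfun (lie_derive _ _) => apply polyfun_lie
  | |- polyfun (fun v => lie_derive ?x ?p v) => apply (@polyfun_lie x p)
  end.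

Lemma lie_polyD x p q v : polyfun p -> polyfun q ->
  lie_derive x (fun u => p u + q u) v = lie_derive x p v + lie_derive x q v.
Proof. exact: deriveD_poly. Qed.

Lemma lie_polyM x p q v : polyfun p -> polyfun q ->
  lie_derive x (fun u => p u * q u) v =
  p v * lie_derive x q v + q v * lie_derive x p v.
Proof. exact: deriveM_poly. Qed.

Lemma lie_polyC x c v : lie_derive x (fun=> c) v = 0.
Proof. exact: (@derive_cst _ _ K^o). Qed.

Lemma opp_mxE m n (A : 'M[K]_(m, n)) i j : (- A) i j = - A i j.
Proof. by rewrite mxE. Qed.

Lemma mxbrE (xi eta : 'M[K]_2) i j : mxbr xi eta i j =
  xi i 0 * eta 0 j + xi i 1 * eta 1 j - (eta i 0 * xi 0 j + eta i 1 * xi 1 j).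
Proof. by rewrite /mxbr mxE opp_mxE !mulmx2. Qed.

Lemma lie_derive_poly_br (xi eta : 'M[K]_2) p v : polyfun p ->
  lie_derive (mxbr xi eta) p v =
  lie_derive xi (lie_derive eta p) v - lie_derive eta (lie_derive xi p) v.
Proof.
move=> pp; elim: pp v => [c|i|f g pf df pg dg|f g pf df pg dg] v.
- have E x : lie_derive x (fun=> c) = fun=> 0.
    by apply/funext => u; rewrite /lie_derive (@derive_cst _ _ K^o).
  by rewrite !E /lie_derive !(@derive_cst _ _ K^o) subr0.
- have E x : lie_derive x (fun u : V => u i 0) =
      fun u => (- x i 0) * u 0 0 + (- x i 1) * u 1 0.
    apply/funext => u; rewrite /lie_derive derive_coord mxE mulmx2.
    by rewrite opprD !mulNr.
  have E2 x a b : lie_derive x (fun u : V => a * u 0 0 + b * u 1 0) v =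
      - (a * (x 0 0 * v 0 0 + x 0 1 * v 1 0) + b * (x 1 0 * v 0 0 + x 1 1 * v 1 0)).
    rewrite /lie_derive deriveD_poly; try by do !constructor.
    rewrite !deriveM_poly; try by do !constructor.
    rewrite !(@derive_cst _ _ K^o) !derive_coord !opp_mxE !mulmx2 !mulr0 !addr0.
    by ring.
  rewrite !E !E2 !mxbrE.
  by case: (ord2P i) => ->; ring.
- have E x : lie_derive x (fun u => f u + g u) =
      fun u => lie_derive x f u + lie_derive x g u.
    by apply/funext => u; rewrite /lie_derive deriveD_poly.
  rewrite !E !lie_polyD; try exact: polyfun_lie.
  by rewrite df dg opprD addrACA.
- have E x : lie_derive x (fun u => f u * g u) =
      fun u => f u * lie_derive x g u + g u * lie_derive x f u.
    by apply/funext => u; rewrite /lie_derive deriveM_poly.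
  rewrite !E !lie_polyD; try by pf.
  rewrite !lie_polyM //; try exact: polyfun_lie.
  by rewrite df dg; gen_lie; ring.
Qed.

Lemma lie_derive_br (U : opn) (xi eta : 'M[K]_2) f v :
  regular_on (cone U) f -> cone U v ->
  lie_derive (mxbr xi eta) f v =
  lie_derive xi (lie_derive eta f) v - lie_derive eta (lie_derive xi f) v.
Proof.
move=> freg Uv; have [p [q [pp qp qv E]]] := freg v Uv.
pose num x u := lie_derive x p u * q u + (-1) * (p u * lie_derive x q u).
have Ex x u : cone U u -> q u ^+ 2 != 0 -> lie_derive x f u = num x u / q u ^+ 2.
  rewrite expf_eq0 /= => Uu qu; rewrite (lie_derive_quot _ pp qp Uu qu E).
  by rewrite /num mulN1r.
have pl x : polyfun (lie_derive x p) by apply: polyfun_lie.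
have ql x : polyfun (lie_derive x q) by apply: polyfun_lie.
have nump x : polyfun (num x) by rewrite /num; pf.
have q2p : polyfun (fun u => q u ^+ 2) by exact: polyfun_exp.
have qv2 : q v ^+ 2 != 0 by rewrite expf_neq0.
rewrite !(lie_derive_quot _ (nump _) q2p Uv qv2 (@Ex _)).
rewrite (lie_derive_quot _ pp qp Uv qv E) !lie_derive_poly_br //.
have q2E : (fun u => q u ^+ 2) = (fun u => q u * q u).
  by apply/funext => u; rewrite expr2.
have numE x y : lie_derive x (num y) v = 
  lie_derive y p v * lie_derive x q v + q v * lie_derive x (lie_derive y p) v
  - (p v * lie_derive x (lie_derive y q) v + lie_derive y q v * lie_derive x p v).
  rewrite /num lie_polyD; try by pf.
  rewrite !lie_polyM; try by pf.
  by rewrite lie_polyC; gen_lie; generalize (p v) (q v); intros; ring.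
rewrite !numE q2E /num.
have qqE x : lie_derive x (fun u => q u * q u) v =
    q v * lie_derive x q v + q v * lie_derive x q v.
  by rewrite lie_polyM.
rewrite !qqE; move: qv; gen_lie; generalize (p v) (q v); intros; by field.
Qed.

End ProjectiveLine.

Section Sections.
Variable K : numClosedFieldType.
Local Notation V := 'cV[K]_2.
Local Notation opn := (opn K).
Implicit Types U W : opn.

(* Sections of O(n) over U: the regular homogeneous functions of degree n on the
   preimage cone U of U, extended by 0 outside cone U so that Leibniz equality
   is equality of sections. In particular sect 0 U is R(U). *)
Definition sect_pred (n : int) (U : opn) : {pred V -> K^o} := fun f => `[<
  [/\ forall v, ~ cone U v -> f v = 0,
      forall c v, c != 0 -> f (c *: v) = c ^ n * f v
    & regular_on (cone U) f] >].

Fact sect_submod n U : submod_closed (sect_pred n U).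
Proof.
split.
  apply/asboolP; split=> // [c v _|]; first by rewrite mulr0.
  exact: regular_cst.
move=> a f g /asboolP[f0 fh fr] /asboolP[g0 gh gr].
have E v : (a *: f + g) v = a * f v + g v by [].
apply/asboolP; split=> [v Uv|c v c0|].
- by rewrite E f0 // g0 // mulr0 addr0.
- by rewrite !E fh // gh // mulrDr mulrCA.
- apply: (@regular_add _ (cone U) (fun v => a * f v) g) => //.
  by apply: regular_mul => //; exact: regular_cst.
Qed.
HB.instance Definition _ n U := GRing.isSubmodClosed.Build K (V -> K^o)
  (sect_pred n U) (sect_submod n U).

Record sect (n : int) (U : opn) : Type := Sect {
  sect_fun :> V -> K^o ; _ : sect_fun \in sect_pred n U }.
HB.instance Definition _ n U := [isSub for @sect_fun n U].
HB.instance Definition _ n U := [Choice of sect n U by <:].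
HB.instance Definition _ n U := [SubChoice_isSubLmodule of sect n U by <:].

Lemma sect0 n U (s : sect n U) v : ~ cone U v -> s v = 0.
Proof. by case: s => s /= /asboolP[h _ _]; apply: h. Qed.
Lemma sect_homog n U (s : sect n U) c v : c != 0 -> s (c *: v) = c ^ n * s v.
Proof. by case: s => s /= /asboolP[_ h _]; apply: h. Qed.
Lemma sect_reg n U (s : sect n U) : regular_on (cone U) s.
Proof. by case: s => s /= /asboolP[]. Qed.

Lemma sectP n U (s s' : sect n U) : (forall v, cone U v -> s v = s' v) -> s = s'.
Proof.
move=> h; apply/val_inj/funext => v /=.
by have [/h//|Uv] := pselect (cone U v); rewrite !sect0.
Qed.

Lemma sectDE n U (s s' : sect n U) v : (s + s') v = s v + s' v.
Proof. by []. Qed.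
Lemma sectNE n U (s : sect n U) v : (- s) v = - s v.
Proof. by []. Qed.
Lemma sectZE n U c (s : sect n U) v : (c *: s) v = c * s v.
Proof. by []. Qed.
Lemma sect0E n U v : (0 : sect n U) v = 0.
Proof. by []. Qed.

(* Extension by zero of the restriction of f to the cone of W. *)
Definition cut (W : opn) (f : V -> K) : V -> K^o :=
  fun v => if `[< cone W v >] then f v else 0.

Lemma cutE W f v : cone W v -> cut W f v = f v.
Proof. by move=> h; rewrite /cut asboolT. Qed.
Lemma cut0 W f v : ~ cone W v -> cut W f v = 0.
Proof. by move=> h; rewrite /cut asboolF. Qed.

Lemma cut_sect n W f : (forall c v, c != 0 -> cone W v -> f (c *: v) = c ^ n * f v) ->
  regular_on (cone W) f -> cut W f \in sect_pred n W.
Proof.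
move=> fh fr; apply/asboolP; split=> [v|c v c0|]; first exact: cut0.
  have [Wv|Wv] := pselect (cone W v).
    by rewrite !cutE ?fh //; apply/(cone_scale W v c0).
  by rewrite !cut0 ?mulr0 // => /(cone_scale W v c0).
by apply: (regular_sub fr) => // v Wv; rewrite cutE.
Qed.

Fact sres_subproof n U W (h : W `<=` U) (s : sect n U) : cut W s \in sect_pred n W.
Proof.
apply: cut_sect => [c v c0 _|]; first exact: sect_homog.
exact: (regular_sub (sect_reg s) (cone_sub h)).
Qed.
Definition sres n U W (h : W `<=` U) (s : sect n U) : sect n W :=
  Sect (sres_subproof h s).

Lemma sresE n U W (h : W `<=` U) (s : sect n U) v : cone W v -> sres h s v = s v.
Proof. exact: cutE. Qed.

Lemma sres_id n U (h : U `<=` U) (s : sect n U) : sres h s = s.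
Proof. by apply: sectP => v Uv; rewrite sresE. Qed.

Lemma sres_comp n U W W' (h : W `<=` U) (h' : W' `<=` W) (h'' : W' `<=` U)
  (s : sect n U) : sres h' (sres h s) = sres h'' s.
Proof. by apply: sectP => v Wv; rewrite !sresE //; apply: cone_sub Wv. Qed.

Lemma sres_linear n U W (h : W `<=` U) c (s s' : sect n U) :
  sres h (c *: s + s') = c *: sres h s + sres h s'.
Proof. by apply: sectP => v Wv; rewrite sectDE sectZE !sresE. Qed.

Fact smul_subproof n U (f : sect 0 U) (s : sect n U) :
  (fun v => f v * s v : K^o) \in sect_pred n U.
Proof.
apply/asboolP; split=> [v Uv|c v c0|]; first by rewrite sect0 // mul0r.
  by rewrite !sect_homog // expr0z mul1r mulrCA.
by apply: regular_mul; apply: sect_reg.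
Qed.
Definition smul n U (f : sect 0 U) (s : sect n U) : sect n U :=
  Sect (smul_subproof f s).

Lemma smulE n U (f : sect 0 U) (s : sect n U) v : smul f s v = f v * s v.
Proof. by []. Qed.

Lemma smul_linear n U (f : sect 0 U) c (s s' : sect n U) :
  smul f (c *: s + s') = c *: smul f s + smul f s'.
Proof.
by apply: sectP => v _; rewrite sectDE sectZE !smulE sectDE sectZE mulrDr mulrCA.
Qed.
Lemma smulD n U (f : sect 0 U) (s s' : sect n U) :
  smul f (s + s') = smul f s + smul f s'.
Proof. by rewrite -[s]scale1r smul_linear !scale1r. Qed.
Lemma smulr0 n U (f : sect 0 U) : smul f (0 : sect n U) = 0.
Proof. by apply: sectP => v _; rewrite smulE !sect0E mulr0. Qed.
Lemma smulN n U (f : sect 0 U) (s : sect n U) : smul f (- s) = - smul f s.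
Proof. by apply: sectP => v _; rewrite smulE !sectNE mulrN. Qed.
Lemma smulZ n U (f : sect 0 U) c (s : sect n U) : smul f (c *: s) = c *: smul f s.
Proof. by apply: sectP => v _; rewrite smulE !sectZE mulrCA. Qed.

Local Notation endo n U :=
  (forall W : opn, oset W `<=` oset U -> sect n W -> sect n W).

Definition endo_res n U W (h : W `<=` U) (T : endo n U) : endo n W :=
  fun W' k => T W' (subset_trans k h).

Definition endo_comm n U (f : sect 0 U) (T : endo n U) : endo n U :=
  fun W h s => T W h (smul (sres h f) s) - smul (sres h f) (T W h s).

(* T is a differential operator of order < k. *)
Fixpoint dord n (k : nat) (U : opn) (T : endo n U) : Prop :=
  match k with
  | 0 => forall W h s, T W h s = 0
  | k'.+1 => forall W (h : W `<=` U) (f : sect 0 W),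
      dord k' (endo_comm f (endo_res h T))
  end.

Lemma endoP n U (S T : endo n U) : (forall W h s, S W h s = T W h s) -> S = T.
Proof.
move=> E; apply: functional_extensionality_dep => W.
by apply: functional_extensionality_dep => h; apply/funext => s.
Qed.

Definition endo_add n U (S T : endo n U) : endo n U :=
  fun W h s => S W h s + T W h s.
Definition endo_scale n U (c : K) (T : endo n U) : endo n U :=
  fun W h s => c *: T W h s.
Definition endo_mul n U (S T : endo n U) : endo n U :=
  fun W h s => S W h (T W h s).

Lemma dord0 n k U (T : endo n U) : (forall W h s, T W h s = 0) -> dord k T.
Proof.
elim: k U T => // k IHk U T T0 W h f; apply: IHk => W' h' s.
by rewrite /endo_comm /endo_res !T0 smulr0 subr0.
Qed.

Lemma dordS n k U (T : endo n U) : dord k T -> dord k.+1 T.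
Proof.
elim: k U T => [|k IHk] U T hT; first exact: (@dord0 n 1).
by move=> W h f; apply/IHk/hT.
Qed.

Lemma dord_le n k k' U (T : endo n U) : (k <= k')%N -> dord k T -> dord k' T.
Proof.
move=> /subnK <-; elim: (k' - k)%N => // d IHd hT.
by rewrite addSn; apply/dordS/IHd.
Qed.

Lemma dord_add n k U (S T : endo n U) : dord k S -> dord k T ->
  dord k (endo_add S T).
Proof.
elim: k U S T => [|k IHk] U S T hS hT.
  by move=> W h s; rewrite /endo_add hS hT addr0.
move=> W h f; have := IHk _ _ _ (hS W h f) (hT W h f).
congr dord; apply: endoP => W' h' s.
by rewrite /endo_add /endo_comm /endo_res /endo_add smulD opprD addrACA.
Qed.

Lemma dord_scale n k U c (T : endo n U) : dord k T -> dord k (endo_scale c T).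
Proof.
elim: k U T => [|k IHk] U T hT.
  by move=> W h s; rewrite /endo_scale hT scaler0.
move=> W h f; have := IHk _ _ (hT W h f); congr dord; apply: endoP => W' h' s.
by rewrite /endo_scale /endo_comm /endo_res /endo_scale smulZ scalerBr.
Qed.

Lemma dord_res n k U W (h : W `<=` U) (T : endo n U) :
  dord k T -> dord k (endo_res h T).
Proof.
case: k => [|k] hT; first by move=> W' h' s; rewrite /endo_res hT.
move=> W' h' f; have := hT W' (subset_trans h' h) f; congr dord.
apply: endoP => W'' h'' s; rewrite /endo_comm /endo_res.
by rewrite (Prop_irrelevance (subset_trans h'' (subset_trans h' h))
  (subset_trans (subset_trans h'' h') h)).
Qed.

Definition endo_additive n U (T : endo n U) : Prop :=
  forall W h s s', T W h (s + s') = T W h s + T W h s'.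

Lemma dord_mul n j k U (S T : endo n U) : endo_additive S ->
  dord j S -> dord k T -> dord (j + k) (endo_mul S T).
Proof.
elim: j k U S T => [|j IHj] k U S T Sadd hS hT.
  by apply: dord0 => W h s; rewrite /endo_mul hS.
have S0 W h : S W h 0 = 0 by apply: (addrI (S W h 0)); rewrite -Sadd !addr0.
have SN W h s : S W h (- s) = - S W h s.
  by apply: (addrI (S W h s)); rewrite -Sadd !subrr S0.
elim: k U S T Sadd hS hT S0 SN => [|k IHk] U S T Sadd hS hT S0 SN.
  by apply: dord0 => W h s; rewrite /endo_mul hT S0.
rewrite addSn => W h f.
have h1 : dord (j + k.+1) (endo_mul (endo_res h S) (endo_comm f (endo_res h T))).
  rewrite addnS -addSn; apply: IHk.
  - by move=> W' h' s s'; rewrite /endo_res Sadd.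
  - exact: dord_res.
  - exact: hT.
  - by move=> W' h'; rewrite /endo_res S0.
  - by move=> W' h' s; rewrite /endo_res SN.
have h2 : dord (j + k.+1) (endo_mul (endo_comm f (endo_res h S)) (endo_res h T)).
  apply: IHj; last exact: dord_res.
    move=> W' h' s s'; rewrite /endo_comm /endo_res smulD !Sadd smulD.
    by rewrite opprD addrACA.
  exact: hS.
have := dord_add h1 h2; congr dord; apply: endoP => W' h' s.
by rewrite /endo_add /endo_mul /endo_comm /endo_res Sadd SN addrA subrK.
Qed.

(* The ring of sections over U of the sheaf of differential endomorphisms of
   O(n): thus diffop (t - 1) is the sheaf D_t, and diffop 0 is D_X. *)
Record diffop (n : int) (U : opn) : Type := Diffop {
  dop :> endo n U ;
  dop_linear : forall W h c s s',
    @dop W h (c *: s + s') = c *: @dop W h s + @dop W h s' ;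
  dop_res : forall W W' h h' (k : W' `<=` W) s,
    @dop W' h' (sres k s) = sres k (@dop W h s) ;
  dop_ord : exists k, dord k dop
}.

Lemma diffopP n U (S T : diffop n U) : (forall W h s, S W h s = T W h s) -> S = T.
Proof.
case: S T => [S S1 S2 S3] [T T1 T2 T3] /= /endoP E.
by subst T; rewrite (Prop_irrelevance S1 T1) (Prop_irrelevance S2 T2)
  (Prop_irrelevance S3 T3).
Qed.

Section DiffopRing.
Variables (n : int) (U : opn).
Implicit Types S T P : diffop n U.

Lemma dopD T W h s s' : T W h (s + s') = T W h s + T W h s'.
Proof. by rewrite -[s]scale1r dop_linear !scale1r. Qed.
Lemma dop0 T W h : T W h 0 = 0.
Proof. by apply: (addrI (T W h 0)); rewrite -dopD !addr0. Qed.
Lemma dopZ T W h c s : T W h (c *: s) = c *: T W h s.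
Proof. by rewrite -[c *: s]addr0 dop_linear dop0 addr0. Qed.
Lemma dopN T W h s : T W h (- s) = - T W h s.
Proof. by rewrite -scaleN1r dopZ scaleN1r. Qed.

HB.instance Definition _ := gen_eqMixin (diffop n U).
HB.instance Definition _ := gen_choiceMixin (diffop n U).

Fact scalar_op_linear (a : K) W (h : W `<=` U) c (s s' : sect n W) :
  a *: (c *: s + s') = c *: (a *: s) + a *: s'.
Proof. by rewrite scalerDr !scalerA mulrC. Qed.
Fact scalar_op_res (a : K) W W' (h : W `<=` U) (h' : W' `<=` U) (k : W' `<=` W)
  (s : sect n W) : a *: sres k s = sres k (a *: s).
Proof. by apply: sectP => v Wv; rewrite sectZE !sresE. Qed.
Fact scalar_op_ord (a : K) :
  exists k, @dord n k U (fun W (h : W `<=` U) (s : sect n W) => a *: s).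
Proof.
exists 1%N => W h f W' h' s.
by rewrite /endo_comm /endo_res smulZ subrr.
Qed.
Definition scalar_op (a : K) : diffop n U :=
  Diffop (scalar_op_linear a) (scalar_op_res a) (scalar_op_ord a).

Fact add_op_linear S T W h c s s' :
  endo_add S T h (c *: s + s') = c *: endo_add S T h s + @endo_add n U S T W h s'.
Proof. by rewrite /endo_add !dop_linear scalerDr addrACA. Qed.
Fact add_op_res S T W W' h h' (k : W' `<=` W) s :
  @endo_add n U S T W' h' (sres k s) = sres k (@endo_add n U S T W h s).
Proof.
by rewrite /endo_add !(dop_res _ h) -[X in sres k (X + _)]scale1r sres_linear scale1r.
Qed.
Fact add_op_ord S T : exists k, dord k (endo_add S T).
Proof.
have [j hS] := dop_ord S; have [k hT] := dop_ord T.
exists (j + k)%N; apply: dord_add; [apply: dord_le hS|apply: dord_le hT].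
  exact: leq_addr.
exact: leq_addl.
Qed.
Definition add_op S T : diffop n U :=
  Diffop (add_op_linear S T) (add_op_res S T) (add_op_ord S T).

Fact mul_op_linear S T W h c s s' :
  endo_mul S T h (c *: s + s') = c *: endo_mul S T h s + @endo_mul n U S T W h s'.
Proof. by rewrite /endo_mul !dop_linear. Qed.
Fact mul_op_res S T W W' h h' (k : W' `<=` W) s :
  @endo_mul n U S T W' h' (sres k s) = sres k (@endo_mul n U S T W h s).
Proof. by rewrite /endo_mul !(dop_res _ h). Qed.
Fact mul_op_ord S T : exists k, dord k (endo_mul S T).
Proof.
have [j hS] := dop_ord S; have [k hT] := dop_ord T.
by exists (j + k)%N; apply: dord_mul => // W h s s'; exact: dopD.
Qed.
Definition mul_op S T : diffop n U :=
  Diffop (mul_op_linear S T) (mul_op_res S T) (mul_op_ord S T).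

Definition opp_op T : diffop n U := mul_op (scalar_op (-1)) T.

Fact add_opA : associative add_op.
Proof. by move=> S T P; apply: diffopP => W h s /=; rewrite /endo_add addrA. Qed.
Fact add_opC : commutative add_op.
Proof. by move=> S T; apply: diffopP => W h s /=; rewrite /endo_add addrC. Qed.
Fact add_op0 : left_id (scalar_op 0) add_op.
Proof.
by move=> S; apply: diffopP => W h s /=; rewrite /endo_add /= scale0r add0r.
Qed.
Fact add_opN : left_inverse (scalar_op 0) opp_op add_op.
Proof.
move=> S; apply: diffopP => W h s /=.
by rewrite /endo_add /= /endo_mul /= scaleN1r scale0r addNr.
Qed.
HB.instance Definition _ := GRing.isZmodule.Build (diffop n U)
  add_opA add_opC add_op0 add_opN.

Fact mul_opA : associative mul_op.
Proof. by move=> S T P; apply: diffopP. Qed.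
Fact mul_op1l : left_id (scalar_op 1) mul_op.
Proof. by move=> S; apply: diffopP => W h s /=; rewrite /endo_mul /= scale1r. Qed.
Fact mul_op1r : right_id (scalar_op 1) mul_op.
Proof. by move=> S; apply: diffopP => W h s /=; rewrite /endo_mul /= scale1r. Qed.
Fact mul_opDl : left_distributive mul_op add_op.
Proof. by move=> S T P; apply: diffopP. Qed.
Fact mul_opDr : right_distributive mul_op add_op.
Proof.
by move=> S T P; apply: diffopP => W h s /=; rewrite /endo_mul /= /endo_add dopD.
Qed.
HB.instance Definition _ := GRing.Zmodule_isPzRing.Build (diffop n U)
  mul_opA mul_op1l mul_op1r mul_opDl mul_opDr.

Lemma dopDE S T W h s : (S + T) W h s = S W h s + T W h s.
Proof. by []. Qed.
Lemma dopME S T W h s : (S * T) W h s = S W h (T W h s).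
Proof. by []. Qed.
Lemma dop1E W h s : (1 : diffop n U) W h s = s.
Proof. exact: scale1r. Qed.
Lemma dopNE T W h s : (- T) W h s = - T W h s.
Proof. exact: scaleN1r. Qed.

Fact scalar_op_nmod : nmod_morphism scalar_op.
Proof. by split=> // a b; apply: diffopP => W h s /=; rewrite /endo_add scalerDl. Qed.
Fact scalar_op_monoid : monoid_morphism scalar_op.
Proof. by split=> // a b; apply: diffopP => W h s /=; rewrite /endo_mul /= scalerA. Qed.
HB.instance Definition _ := GRing.isNmodMorphism.Build K (diffop n U) scalar_op
  scalar_op_nmod.
HB.instance Definition _ := GRing.isMonoidMorphism.Build K (diffop n U) scalar_op
  scalar_op_monoid.

Lemma scalar_opC c T : scalar_op c * T = T * scalar_op c.
Proof. by apply: diffopP => W h s; rewrite !dopME /= dopZ. Qed.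

End DiffopRing.

Section DiffopRestriction.
Variables (n : int) (U W : opn) (h : W `<=` U).

Fact diffop_res_linear (T : diffop n U) W' k c s s' :
  endo_res h T k (c *: s + s') = c *: endo_res h T k s + @endo_res n U W h T W' k s'.
Proof. by rewrite /endo_res dop_linear. Qed.
Fact diffop_res_res (T : diffop n U) W1 W2 h1 h2 (k : W2 `<=` W1) s :
  @endo_res n U W h T W2 h2 (sres k s) = sres k (@endo_res n U W h T W1 h1 s).
Proof. by rewrite /endo_res (dop_res _ (subset_trans h1 h)). Qed.
Fact diffop_res_ord (T : diffop n U) : exists k, dord k (endo_res h T).
Proof. by have [k hT] := dop_ord T; exists k; apply: dord_res. Qed.
Definition diffop_res (T : diffop n U) : diffop n W :=
  Diffop (diffop_res_linear T) (@diffop_res_res T) (diffop_res_ord T).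

Fact diffop_res_nmod : nmod_morphism diffop_res.
Proof. by split=> [|S T]; apply: diffopP. Qed.
Fact diffop_res_monoid : monoid_morphism diffop_res.
Proof. by split=> [|S T]; apply: diffopP. Qed.
HB.instance Definition _ := GRing.isNmodMorphism.Build _ _ diffop_res
  diffop_res_nmod.
HB.instance Definition _ := GRing.isMonoidMorphism.Build _ _ diffop_res
  diffop_res_monoid.

End DiffopRestriction.

Section LieOp.
Variables (n : int) (U : opn).

Fact lie_sect_subproof (x : sl2 K) W (s : sect n W) :
  cut W (lie_derive x s) \in sect_pred n W.
Proof.
apply: cut_sect => [c v c0 Wv|]; last exact/regular_lie/sect_reg.
apply: (lie_derive_homog _ (sect_reg s) Wv c0).
by move=> u; apply: sect_homog.
Qed.
Definition lie_sect (x : sl2 K) W (s : sect n W) : sect n W :=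
  Sect (lie_sect_subproof x s).

Lemma lie_sectE x W (s : sect n W) v : cone W v -> lie_sect x s v = lie_derive x s v.
Proof. exact: cutE. Qed.

End LieOp.

Section LieOp2.
Variables (n : int) (U : opn).

Fact lie_op_linear x W (h : W `<=` U) c (s s' : sect n W) :
  lie_sect x (c *: s + s') = c *: lie_sect x s + lie_sect x s'.
Proof.
apply: sectP => v Wv; rewrite sectDE sectZE !lie_sectE //.
rewrite (_ : (c *: s + s' : sect n W) = (fun u => (fun=> c) u * s u + s' u) :> (V -> K)) //.
rewrite (@lie_deriveD _ _ W _ s') //; first last.
- exact: sect_reg.
- by apply: regular_mul (sect_reg s); exact: regular_cst.
rewrite (@lie_deriveM _ _ W _ s) //; first last.
- exact: sect_reg.
- exact: regular_cst.
by rewrite /lie_derive (@derive_cst _ _ K^o) mulr0 addr0.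
Qed.

Fact lie_op_res x W W' (h : W `<=` U) (h' : W' `<=` U) (k : W' `<=` W) (s : sect n W) :
  lie_sect x (sres k s) = sres k (lie_sect x s).
Proof.
apply: sectP => v Wv; rewrite sresE // !lie_sectE //; last exact: cone_sub Wv.
by apply: (@lie_derive_local _ _ W') => // u Wu; rewrite sresE.
Qed.

Lemma lie_sect_smul x W (f : sect 0 W) (s : sect n W) :
  lie_sect x (smul f s) = smul f (lie_sect x s) + smul (lie_sect x f) s.
Proof.
apply: sectP => v Wv; rewrite sectDE !smulE !lie_sectE //.
rewrite (@lie_deriveM _ _ W f s) //; try exact: sect_reg.
by rewrite [s v * _]mulrC.
Qed.

Fact lie_op_ord (x : sl2 K) :
  exists k, @dord n k U (fun W (h : W `<=` U) (s : sect n W) => lie_sect x s).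
Proof.
exists 2%N => W h f W' h' g W'' h'' s.
rewrite /endo_comm /endo_res !lie_sect_smul.
apply: sectP => v Wv.
rewrite !(sectDE, sectNE, smulE, sect0E).
by ring.
Qed.

Definition lie_op (x : sl2 K) : diffop n U :=
  Diffop (lie_op_linear x) (lie_op_res x) (lie_op_ord x).

Lemma lie_opD : {morph lie_op : x y / x + y}.
Proof.
move=> x y; apply: diffopP => W h s; rewrite dopDE /=.
apply: sectP => v Wv; rewrite sectDE !lie_sectE //.
rewrite (_ : sl2_mx (x + y) = 1 *: sl2_mx x + sl2_mx y); last by rewrite scale1r.
by rewrite (@lie_derive_linear _ W) ?mul1r //; exact: sect_reg.
Qed.
Lemma lie_opZ c x : lie_op (c *: x) = scalar_op n U c * lie_op x.
Proof.
apply: diffopP => W h s; rewrite dopME /=.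
apply: sectP => v Wv; rewrite sectZE !lie_sectE //.
rewrite (_ : sl2_mx (c *: x) = c *: sl2_mx x + 0); last by rewrite addr0.
rewrite (@lie_derive_linear _ W) //; last exact: sect_reg.
by rewrite /lie_derive mul0mx oppr0 derive0 addr0.
Qed.
Lemma lie_op_br x y : lie_op (sl2_br x y) = lie_op x * lie_op y - lie_op y * lie_op x.
Proof.
apply: diffopP => W h s; rewrite dopDE dopNE !dopME /=.
apply: sectP => v Wv; rewrite sectDE sectNE !lie_sectE //.
rewrite (@lie_derive_br _ W) //; last exact: sect_reg.
by congr (_ - _); apply: (@lie_derive_local _ _ W) => // u Wu; rewrite lie_sectE.
Qed.

End LieOp2.

End Sections.

Section DModules.
Variable K : numClosedFieldType.
Local Notation V := 'cV[K]_2.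
Local Notation opn := (opn K).

(* A sheaf of left modules over the restriction of diffop n to the open set O. *)
Record dmod (n : int) (O : opn) : Type := Dmod {
  dsec : forall W : opn, W `<=` O -> lmodType (diffop n W) ;
  dres : forall (W W' : opn) (h : W `<=` O) (h' : W' `<=` O), W' `<=` W ->
    @dsec W h -> @dsec W' h' ;
  dresD : forall (W W' : opn) h h' (k : W' `<=` W) s s',
    @dres W W' h h' k (s + s') = @dres W W' h h' k s + @dres W W' h h' k s' ;
  dresZ : forall (W W' : opn) h h' (k : W' `<=` W) (T : diffop n W) s,
    @dres W W' h h' k (T *: s) = diffop_res k T *: @dres W W' h h' k s ;
  dres_id : forall (W : opn) h (k : W `<=` W) s, @dres W W h h k s = s ;
  dres_comp : forall (W W' W'' : opn) h h' h'' (k : W' `<=` W) (k' : W'' `<=` W')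
    (k'' : W'' `<=` W) s,
    @dres W' W'' h' h'' k' (@dres W W' h h' k s) = @dres W W'' h h'' k'' s ;
  dsep : forall (W : opn) h (I : Type) (C : I -> opn) (hC : forall i, C i `<=` O)
    (k : forall i, C i `<=` W), (forall x, oset W x -> exists i, oset (C i) x) ->
    forall s s', (forall i, @dres W (C i) h (hC i) (k i) s =
                            @dres W (C i) h (hC i) (k i) s') -> s = s' ;
  dglue : forall (W : opn) h (I : Type) (C : I -> opn) (hC : forall i, C i `<=` O)
    (k : forall i, C i `<=` W), (forall x, oset W x -> exists i, oset (C i) x) ->
    forall s : (forall i, @dsec (C i) (hC i)),
    (forall i j (W' : opn) (h' : W' `<=` O) (ki : W' `<=` C i) (kj : W' `<=` C j),
      @dres (C i) W' (hC i) h' ki (s i) = @dres (C j) W' (hC j) h' kj (s j)) ->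
    exists s0, forall i, @dres W (C i) h (hC i) (k i) s0 = s i
}.
Arguments dsec {n O} M W h : rename.
Arguments dres {n O} M {W W'} h h' k s : rename.

(* O(n) as a module over its sheaf of differential endomorphisms. *)
Definition tautsec (n : int) (W : opn) : Type := sect n W.

Section TautologicalModule.
Variables (n : int) (W : opn).
HB.instance Definition _ := GRing.Zmodule.on (tautsec n W).
Definition taut_scale (T : diffop n W) (s : tautsec n W) : tautsec n W :=
  T W (@subset_refl _ W) s.
Fact taut_scaleA S T s : taut_scale S (taut_scale T s) = taut_scale (S * T) s.
Proof. by []. Qed.
Fact taut_scale1 : left_id 1 taut_scale.
Proof. by move=> s; rewrite /taut_scale dop1E. Qed.
Fact taut_scaleDr : right_distributive taut_scale +%R.
Proof. by move=> T s s'; rewrite /taut_scale dopD. Qed.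
Fact taut_scaleDl s : {morph taut_scale^~ s : S T / S + T}.
Proof. by move=> S T; rewrite /taut_scale dopDE. Qed.
HB.instance Definition _ := GRing.Zmodule_isLmodule.Build (diffop n W) (tautsec n W)
  taut_scaleA taut_scale1 taut_scaleDr taut_scaleDl.
End TautologicalModule.

Section Taut.
Variables (n : int) (O : opn).

Definition taut_sec (W : opn) (h : W `<=` O) : lmodType (diffop n W) := tautsec n W.
Definition taut_res (W W' : opn) (h : W `<=` O) (h' : W' `<=` O) (k : W' `<=` W)
  (s : taut_sec h) : taut_sec h' := sres k (s : sect n W).

Fact taut_resD (W W' : opn) h h' (k : W' `<=` W) s s' :
  @taut_res W W' h h' k (s + s') = taut_res h' k s + taut_res h' k s'.
Proof.
by apply: sectP => v Wv; rewrite sectDE /taut_res !sresE.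
Qed.
Fact taut_resZ (W W' : opn) h h' (k : W' `<=` W) (T : diffop n W) s :
  @taut_res W W' h h' k (T *: s) = diffop_res k T *: taut_res h' k s.
Proof.
rewrite /taut_res -(@dop_res _ _ _ T W W' _ (subset_trans (@subset_refl _ W') k)).
by [].
Qed.
Fact taut_res_id (W : opn) h (k : W `<=` W) s : @taut_res W W h h k s = s.
Proof. exact: sres_id. Qed.
Fact taut_res_comp (W W' W'' : opn) h h' h'' (k : W' `<=` W) (k' : W'' `<=` W')
    (k'' : W'' `<=` W) s :
  @taut_res W' W'' h' h'' k' (@taut_res W W' h h' k s) = @taut_res W W'' h h'' k'' s.
Proof. exact: sres_comp. Qed.

Lemma cone_cover (W : opn) (I : Type) (C : I -> opn) :
  (forall x, oset W x -> exists i, oset (C i) x) ->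
  forall v, cone W v -> exists i, cone (C i) v.
Proof. by move=> cov v [L /cov[i iL] LE]; exists i, L. Qed.

Fact taut_sep (W : opn) h (I : Type) (C : I -> opn) (hC : forall i, C i `<=` O)
    (k : forall i, C i `<=` W) : (forall x, oset W x -> exists i, oset (C i) x) ->
  forall s s', (forall i, @taut_res W (C i) h (hC i) (k i) s =
                          @taut_res W (C i) h (hC i) (k i) s') -> s = s'.
Proof.
move=> cov s s' E; apply: sectP => v Wv.
have [i iv] := cone_cover cov Wv.
have := congr1 (fun t : sect n (C i) => t v) (E i).
by rewrite /taut_res !sresE.
Qed.

Fact taut_glue (W : opn) h (I : Type) (C : I -> opn) (hC : forall i, C i `<=` O)
    (k : forall i, C i `<=` W) : (forall x, oset W x -> exists i, oset (C i) x) ->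
  forall s : (forall i, taut_sec (hC i)),
  (forall i j (W' : opn) (h' : W' `<=` O) (ki : W' `<=` C i) (kj : W' `<=` C j),
    @taut_res (C i) W' (hC i) h' ki (s i) = @taut_res (C j) W' (hC j) h' kj (s j)) ->
  exists s0, forall i, @taut_res W (C i) h (hC i) (k i) s0 = s i.
Proof.
move=> cov s E.
pose t i : sect n (C i) := s i.
pose f v : K := get [set a | exists i, cone (C i) v /\ a = t i v].
have fE i v : cone (C i) v -> f v = t i v.
  move=> iv; rewrite /f; case: xgetP => [a _ [j [jv ->]]|/(_ (t i v))]; last first.
    by case; exists i.
  have kj : opnI (C i) (C j) `<=` C j by move=> x [].
  have ki : opnI (C i) (C j) `<=` C i by move=> x [].
  have := congr1 (fun u : sect n (opnI (C i) (C j)) => u v)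
    (E i j _ (subset_trans ki (hC i)) ki kj).
  by rewrite /taut_res !sresE //; apply/coneI.
have fP : cut W f \in sect_pred n W.
  apply: cut_sect => [c v c0 Wv|v Wv].
    have [i iv] := cone_cover cov Wv.
    by rewrite !(fE i) //; [exact: sect_homog|apply/cone_scale].
  have [i iv] := cone_cover cov Wv.
  have [p [q [pp qp qv pq]]] := sect_reg (t i) iv.
  have [r [rp rv rC]] := opnP iv.
  exists (fun v => p v * r v), (fun v => q v * r v); split.
  - by constructor.
  - by constructor.
  - by rewrite mulf_neq0.
  move=> u Wu; rewrite mulf_eq0 negb_or => /andP[qu ru].
  have iu : cone (C i) u by apply: rC => //; exact: cone_neq0 Wu.
  by rewrite (fE i) // pq // -mulf_div divff // mulr1.
exists (Sect fP) => i; apply: sectP => v iv.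
by rewrite /taut_res sresE // [LHS]cutE ?(fE i) //; exact: cone_sub iv.
Qed.

Definition taut : dmod n O :=
  Dmod taut_resD taut_resZ taut_res_id taut_res_comp taut_sep taut_glue.

End Taut.

(* Pull-back of the action along a morphism f of sheaves of rings on O. *)
Section ModulePullback.
Variables (n m : int) (O : opn).
Variable f : forall W : opn, W `<=` O -> {rmorphism diffop n W -> diffop m W}.
Hypothesis f_res : forall (W W' : opn) (h : W `<=` O) (h' : W' `<=` O) (k : W' `<=` W) T,
  f h' (diffop_res k T) = diffop_res k (f h T).
Variable M : dmod m O.

Definition dpull_sec (W : opn) (h : W `<=` O) : lmodType (diffop n W) :=
  rscal (f h) (dsec M W h).
Definition dpull_res (W W' : opn) (h : W `<=` O) (h' : W' `<=` O) (k : W' `<=` W)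
  (s : dpull_sec h) : dpull_sec h' := dres M h h' k s.

Fact dpull_resZ (W W' : opn) h h' (k : W' `<=` W) (T : diffop n W) s :
  @dpull_res W W' h h' k (T *: s) = diffop_res k T *: dpull_res h' k s.
Proof.
rewrite /dpull_res [LHS](@dresZ _ _ M _ _ h h' k (f h T) s) -(f_res h h' k).
by [].
Qed.

Definition dpull : dmod n O :=
  @Dmod n O dpull_sec dpull_res (@dresD _ _ M)
    dpull_resZ (@dres_id _ _ M) (@dres_comp _ _ M) (@dsep _ _ M) (@dglue _ _ M).
End ModulePullback.

(* Direct image under the inclusion of the open set O in CP^1. *)
Section DirectImage.
Variables (n : int) (O : opn) (M : dmod n O).

Fact opnIl (U : opn) : opnI U O `<=` U. Proof. by move=> x []. Qed.
Fact opnIr (U : opn) : opnI U O `<=` O. Proof. by move=> x []. Qed.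
Fact opnIS (U U' : opn) : U' `<=` U -> opnI U' O `<=` opnI U O.
Proof. by move=> k x [/k Ux Ox]; split. Qed.

Definition dimage_sec (U : opn) (h : U `<=` opnT K) : lmodType (diffop n U) :=
  rscal (diffop_res (@opnIl U)) (dsec M (opnI U O) (@opnIr U)).
Definition dimage_res (U U' : opn) (h : U `<=` opnT K) (h' : U' `<=` opnT K)
  (k : U' `<=` U) (s : dimage_sec h) : dimage_sec h' :=
  dres M (@opnIr U) (@opnIr U') (opnIS k) s.

Fact dimage_resD (U U' : opn) h h' (k : U' `<=` U) s s' :
  @dimage_res U U' h h' k (s + s') = dimage_res h' k s + dimage_res h' k s'.
Proof. exact: dresD. Qed.
Fact dimage_resZ (U U' : opn) h h' (k : U' `<=` U) (T : diffop n U) s :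
  @dimage_res U U' h h' k (T *: s) = diffop_res k T *: dimage_res h' k s.
Proof.
have E : diffop_res (opnIS k) (diffop_res (@opnIl U) T) =
    diffop_res (@opnIl U') (diffop_res k T).
  apply: diffopP => W h1 s1 /=; rewrite /endo_res.
  by congr (dop T _ s1); apply: Prop_irrelevance.
rewrite /dimage_res [LHS](@dresZ _ _ M _ _ _ _ _ (diffop_res (@opnIl U) T) s) E.
by [].
Qed.
Fact dimage_res_id (U : opn) h (k : U `<=` U) s : @dimage_res U U h h k s = s.
Proof. exact: dres_id. Qed.
Fact dimage_res_comp (U U' U'' : opn) h h' h'' (k : U' `<=` U) (k' : U'' `<=` U')
    (k'' : U'' `<=` U) s :
  @dimage_res U' U'' h' h'' k' (@dimage_res U U' h h' k s) =
  @dimage_res U U'' h h'' k'' s.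
Proof. exact: dres_comp. Qed.
Fact dimage_sep (U : opn) h (I : Type) (C : I -> opn) (hC : forall i, C i `<=` opnT K)
    (k : forall i, C i `<=` U) : (forall x, oset U x -> exists i, oset (C i) x) ->
  forall s s', (forall i, @dimage_res U (C i) h (hC i) (k i) s =
                          @dimage_res U (C i) h (hC i) (k i) s') -> s = s'.
Proof.
move=> cov s s' E.
apply: (@dsep _ _ M _ (@opnIr U) I (fun i => opnI (C i) O)
  (fun i => @opnIr (C i)) (fun i => opnIS (k i))); last exact: E.
by move=> x [/cov[i ix] Ox]; exists i; split.
Qed.
Fact dimage_glue (U : opn) h (I : Type) (C : I -> opn) (hC : forall i, C i `<=` opnT K)
    (k : forall i, C i `<=` U) : (forall x, oset U x -> exists i, oset (C i) x) ->
  forall s : (forall i, dimage_sec (hC i)),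
  (forall i j (W' : opn) (h' : W' `<=` opnT K) (ki : W' `<=` C i) (kj : W' `<=` C j),
    @dimage_res (C i) W' (hC i) h' ki (s i) =
    @dimage_res (C j) W' (hC j) h' kj (s j)) ->
  exists s0, forall i, @dimage_res U (C i) h (hC i) (k i) s0 = s i.
Proof.
move=> cov s E.
apply: (@dglue _ _ M _ (@opnIr U) I (fun i => opnI (C i) O)
  (fun i => @opnIr (C i)) (fun i => opnIS (k i))).
  by move=> x [/cov[i ix] Ox]; exists i; split.
move=> i j W' h' ki kj.
have kW : W' `<=` opnI W' O by move=> x Wx; split=> //; exact: h'.
have ki' : W' `<=` C i by move=> x /ki[].
have kj' : W' `<=` C j by move=> x /kj[].
have := E i j W' (fun _ _ => Logic.I) ki' kj'.
move=> /(congr1 (dres M (@opnIr W') h' kW)).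
by rewrite /dimage_res !(@dres_comp _ _ M _ _ _ _ _ _ _ _ ki)
  !(@dres_comp _ _ M _ _ _ _ _ _ _ _ kj).
Qed.

Definition dimage : dmod n (opnT K) :=
  Dmod dimage_resD dimage_resZ dimage_res_id dimage_res_comp dimage_sep dimage_glue.
End DirectImage.

Definition global_sections n (M : dmod n (opnT K)) : gmod K :=
  pullback (@scalar_opC _ n (opnT K)) (@lie_opD _ n (opnT K)) (@lie_opZ _ n (opnT K))
    (@lie_op_br _ n (opnT K)) (dsec M (opnT K) (@subset_refl _ _)).

Definition vec0 : V := delta_mx 0 0.

Fact pt0_subproof : \dim <[vec0]>%VS == 1%N.
Proof.
rewrite dim_vline (_ : vec0 != 0) //; apply/eqP => /matrixP/(_ 0 0).
by rewrite !mxE => /eqP; rewrite oner_eq0.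
Qed.
(* The point [1 : 0]. *)
Definition pt0 : P1 K := Sub <[vec0]>%VS pt0_subproof.

Lemma cone_Uinf v : cone (~` [set pt0]) v <-> v 1 0 != 0.
Proof.
split=> [[L L0 LE]|v1].
  apply: contra_not_neq L0 => v1 /=; apply/val_inj; rewrite SubK LE.
  have v0 : v 0 0 != 0.
    apply: contraT; rewrite negbK => /eqP v0.
    have: v != 0 by apply: (@cone_neq0 _ setT); exists L.
    case/vec0P => i; case: (ord2P i) => ->; rewrite ?v0 ?v1 eqxx //.
  rewrite -(vline_scale _ v0); congr <[_]>%VS.
  apply/matrixP => i j; rewrite (ord1 j) !mxE.
  by case: (ord2P i) => ->; rewrite /= ?v1 ?mulr1 ?mulr0.
have v0 : v != 0 by apply: contraNneq v1 => ->; rewrite mxE.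
have [L _ LE] : cone setT v by apply/coneT.
exists L => //= L0; move: LE; rewrite L0 SubK => /esym vE.
have /vlineP[c cE] : v \in <[vec0]>%VS by rewrite -vE memv_line.
by move: v1; rewrite cE !mxE /= mulr0 eqxx.
Qed.

Fact zopen_Uinf : zopen (~` [set pt0]).
Proof.
move=> v /cone_Uinf v1; exists (fun v : V => v 1 0); split=> //; first by constructor.
by move=> u _ /cone_Uinf.
Qed.
Definition Uinf : opn := Opn zopen_Uinf.

Section Trivialization.
Variable n : int.

Lemma Uinf_neq0 (W : opn) v : W `<=` Uinf -> cone W v -> v 1 0 != 0.
Proof. by move=> h Wv; apply/cone_Uinf; apply: cone_sub Wv. Qed.

Lemma sect_triv (W : opn) (s : sect n W) (v : V) : v 1 0 != 0 ->
  s ((v 1 0)^-1 *: v) = v 1 0 ^ (- n) * s v.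
Proof. by move=> v1; rewrite sect_homog ?invr_eq0 // exprz_inv. Qed.

Fact triv_subproof (W : opn) (h : W `<=` Uinf) (s : sect n W) :
  cut W (fun v : V => s ((v 1 0)^-1 *: v)) \in sect_pred 0 W.
Proof.
apply: cut_sect => [c v c0 Wv|].
  rewrite expr0z mul1r mxE invfM scalerA; congr (s (_ *: _)).
  by rewrite mulrAC mulVf // mul1r.
apply: (@regular_sub _ (cone W) _ (fun v : V => v 1 0 ^ (- n) * s v)) => //.
  apply: regular_mul (sect_reg s).
  apply: (@regular_expz _ _ (fun v : V => v 1 0)); first by constructor.
  by move=> v Wv; exact: Uinf_neq0 h Wv.
by move=> v Wv; rewrite sect_triv //; exact: Uinf_neq0 h Wv.
Qed.
(* The trivialization f |-> f (w, 1) of O(n) on U_oo, w = v 0 0 / v 1 0. *)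
Definition triv (W : opn) (h : W `<=` Uinf) (s : sect n W) : sect 0 W :=
  Sect (triv_subproof h s).

Fact triv_inv_subproof (W : opn) (h : W `<=` Uinf) (q : sect 0 W) :
  cut W (fun v : V => v 1 0 ^ n * q v) \in sect_pred n W.
Proof.
apply: cut_sect => [c v c0 Wv|].
  by rewrite sect_homog // expr0z mul1r mxE exprzMl ?unitfE // ?mulrA //;
    exact: Uinf_neq0 h Wv.
apply: regular_mul (sect_reg q).
apply: (@regular_expz _ _ (fun v : V => v 1 0)); first by constructor.
by move=> v Wv; exact: Uinf_neq0 h Wv.
Qed.
Definition triv_inv (W : opn) (h : W `<=` Uinf) (q : sect 0 W) : sect n W :=
  Sect (triv_inv_subproof h q).

Lemma trivE (W : opn) (h : W `<=` Uinf) (s : sect n W) v : cone W v ->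
  triv h s v = v 1 0 ^ (- n) * s v.
Proof.
by move=> Wv; rewrite [LHS]cutE // sect_triv //; exact: Uinf_neq0 h Wv.
Qed.
Lemma triv_invE (W : opn) (h : W `<=` Uinf) (q : sect 0 W) v : cone W v ->
  triv_inv h q v = v 1 0 ^ n * q v.
Proof. exact: cutE. Qed.

Lemma trivK (W : opn) (h : W `<=` Uinf) : cancel (triv h) (triv_inv h).
Proof.
move=> s; apply: sectP => v Wv; rewrite triv_invE // trivE // mulrA.
by rewrite -expfzDr ?subrr ?expr0z ?mul1r //; exact: Uinf_neq0 h Wv.
Qed.
Lemma triv_invK (W : opn) (h : W `<=` Uinf) : cancel (triv_inv h) (triv h).
Proof.
move=> s; apply: sectP => v Wv; rewrite trivE // triv_invE // mulrA.
by rewrite -expfzDr ?addNr ?expr0z ?mul1r //; exact: Uinf_neq0 h Wv.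
Qed.

Lemma triv_linear (W : opn) (h : W `<=` Uinf) c (s s' : sect n W) :
  triv h (c *: s + s') = c *: triv h s + triv h s'.
Proof.
by apply: sectP => v Wv; rewrite sectDE sectZE !trivE // sectDE sectZE mulrDr mulrCA.
Qed.
Lemma triv_inv_linear (W : opn) (h : W `<=` Uinf) c (s s' : sect 0 W) :
  triv_inv h (c *: s + s') = c *: triv_inv h s + triv_inv h s'.
Proof.
by apply: sectP => v Wv;
  rewrite sectDE sectZE !triv_invE // sectDE sectZE mulrDr mulrCA.
Qed.
Lemma trivD (W : opn) (h : W `<=` Uinf) (s s' : sect n W) :
  triv h (s + s') = triv h s + triv h s'.
Proof. by rewrite -[s]scale1r triv_linear !scale1r. Qed.
Lemma triv0 (W : opn) (h : W `<=` Uinf) : triv h 0 = 0.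
Proof. by apply: (addrI (triv h 0)); rewrite -trivD !addr0. Qed.
Lemma trivN (W : opn) (h : W `<=` Uinf) (s : sect n W) : triv h (- s) = - triv h s.
Proof. by apply: (addrI (triv h s)); rewrite -trivD !subrr triv0. Qed.

Lemma triv_res (W W' : opn) (h : W `<=` Uinf) (h' : W' `<=` Uinf) (k : W' `<=` W)
  (s : sect n W) : triv h' (sres k s) = sres k (triv h s).
Proof.
apply: sectP => v Wv; have Wv' := cone_sub k Wv.
by rewrite sresE // !trivE // sresE.
Qed.
Lemma triv_inv_res (W W' : opn) (h : W `<=` Uinf) (h' : W' `<=` Uinf)
  (k : W' `<=` W) (s : sect 0 W) : triv_inv h' (sres k s) = sres k (triv_inv h s).
Proof.
apply: sectP => v Wv; have Wv' := cone_sub k Wv.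
by rewrite sresE // !triv_invE // sresE.
Qed.

Lemma triv_smul (W : opn) (h : W `<=` Uinf) (f : sect 0 W) (s : sect n W) :
  triv h (smul f s) = smul f (triv h s).
Proof. by apply: sectP => v Wv; rewrite smulE !trivE // smulE mulrCA. Qed.
Lemma triv_inv_smul (W : opn) (h : W `<=` Uinf) (f s : sect 0 W) :
  triv_inv h (smul f s) = smul f (triv_inv h s).
Proof. by apply: sectP => v Wv; rewrite smulE !triv_invE // smulE mulrCA. Qed.

Definition endo_triv (U : opn) (h : U `<=` Uinf)
  (T : forall W : opn, W `<=` U -> sect n W -> sect n W)
  (W : opn) (k : W `<=` U) (q : sect 0 W) : sect 0 W :=
  triv (subset_trans k h) (T W k (triv_inv (subset_trans k h) q)).

Lemma dord_triv k (U : opn) (h : U `<=` Uinf)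
  (T : forall W : opn, W `<=` U -> sect n W -> sect n W) : dord k T -> dord k (endo_triv h T).
Proof.
elim: k U h T => [|k IHk] U h T hT.
  by move=> W l q; rewrite /endo_triv hT triv0.
move=> W l f; have := IHk W (subset_trans l h) _ (hT W l f).
congr dord; apply: endoP => W' l' q.
rewrite /endo_comm /endo_res /endo_triv.
rewrite !(Prop_irrelevance (subset_trans (subset_trans l' l) h)
  (subset_trans l' (subset_trans l h))).
by rewrite trivD trivN triv_smul triv_inv_smul.
Qed.

Section TrivDiffop.
Variables (U : opn) (h : U `<=` Uinf).

Fact triv_op_linear (T : diffop n U) (W : opn) k c s s' :
  endo_triv h T k (c *: s + s') =
  c *: endo_triv h T k s + @endo_triv U h T W k s'.
Proof. by rewrite /endo_triv triv_inv_linear dop_linear triv_linear. Qed.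
Fact triv_op_res (T : diffop n U) (W W' : opn) k k' (l : W' `<=` W) s :
  @endo_triv U h T W' k' (sres l s) = sres l (@endo_triv U h T W k s).
Proof.
rewrite /endo_triv (triv_inv_res (subset_trans k h)) (dop_res _ k).
exact: triv_res.
Qed.
Fact triv_op_ord (T : diffop n U) : exists k, dord k (endo_triv h T).
Proof. by have [k hT] := dop_ord T; exists k; apply: dord_triv. Qed.
(* The identification of the differential endomorphisms of O(n) with those of
   the structure sheaf over U in U_oo. *)
Definition triv_op (T : diffop n U) : diffop 0 U :=
  Diffop (triv_op_linear T) (triv_op_res T) (triv_op_ord T).

Fact triv_op_nmod : nmod_morphism triv_op.
Proof.
split=> [|S T]; apply: diffopP => W k s /=; rewrite /endo_triv /=.
  by rewrite !scale0r triv0.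
by rewrite /endo_add trivD.
Qed.
Fact triv_op_monoid : monoid_morphism triv_op.
Proof.
split=> [|S T]; apply: diffopP => W k s /=; rewrite /endo_triv /=.
  by rewrite !scale1r triv_invK.
by rewrite /endo_mul /endo_triv trivK.
Qed.
HB.instance Definition _ := GRing.isNmodMorphism.Build _ _ triv_op triv_op_nmod.
HB.instance Definition _ := GRing.isMonoidMorphism.Build _ _ triv_op triv_op_monoid.
Definition triv_morph : {rmorphism diffop n U -> diffop 0 U} := triv_op.
End TrivDiffop.

Lemma triv_morph_res (U U' : opn) (h : U `<=` Uinf) (h' : U' `<=` Uinf)
  (k : U' `<=` U) T :
  triv_morph h' (diffop_res k T) = diffop_res k (triv_morph h T).
Proof.
apply: diffopP => W l s /=; rewrite /endo_triv /= /endo_res /endo_triv.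
by rewrite (Prop_irrelevance (subset_trans l h') (subset_trans (subset_trans l k) h)).
Qed.

(* The structure sheaf of U_oo as a module over diffop n restricted to U_oo. *)
Definition O_Uinf : dmod n Uinf := dpull triv_morph_res (taut 0 Uinf).

End Trivialization.

(* The standard Harish-Chandra sheaf for D_t attached to U_oo. *)
Definition I_Uinf (t : int) : dmod (t - 1) (opnT K) := dimage (O_Uinf (t - 1)).

End DModules.

(* Main.v *)
(* The global sections form the space C[w], with basis the w^k, of weight
   t - 1 - 2k, and E w^k = - k w^(k-1).  Evaluation at w = 0 is a linear form ell
   with ell (F q) = 0 and ell (H q) = (t - 1) ell q, so that
     <q, u (x) c> = c ell (sigma(u) q)
   is a well-defined contravariant pairing of C[w] with M(t - 1).  Since
   <q, F^k (x) 1> = ell (E^k q) = (-1)^k k! q_k and the F^k (x) 1 span M(t - 1),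
   the pairing identifies C[w] with the linear forms on M(t - 1) that vanish on
   almost all F^k (x) 1, which is the contragredient dual.  The linear
   independence of the F^k (x) 1 (PBW) is not needed. *)
Require Import Defs.
From HB Require Import structures.
From mathcomp Require Import all_boot all_order all_algebra.
From mathcomp Require Import complex.
From mathcomp Require Import zify ring.
From mathcomp Require Import all_classical all_reals all_analysis.
Import Order.TTheory GRing.Theory Num.Theory.
Local Open Scope ring_scope.
Local Open Scope complex_scope.

Set Implicit Arguments.
Unset Strict Implicit.
Unset Printing Implicit Defensive.

(** * The Verma module: action on the vectors [F^k (x) 1] *)

Section VermaBasis.
Variables (K : fieldType) (mu : K).

Let M := verma mu.
Definition verma_hw : M := tens (Uincl K) (1 : Usl2 K) (1 : Cmu mu).
Definition verma_vec k : M := iter k (gact (sl2_F K)) verma_hw.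

Lemma tensZ (B A : pzRingType) (j : {rmorphism B -> A}) (Q : lmodType B) a b (q : Q) :
  a *: tens j b q = tens j (a * b) q.
Proof. exact: ext_scaleE. Qed.

Lemma tens_balanced (B A : pzRingType) (j : {rmorphism B -> A}) (Q : lmodType B) b (q : Q) :
  j b *: tens j 1 q = tens j 1 (b *: q).
Proof.
by rewrite tensZ mulr1 -[j b]mul1r; apply/ext_piP/teq_balanced.
Qed.

Lemma Uincl_gen (A : borel K) :
  Uincl K (env_gen (@borel_br K) A) = env_gen (@sl2_br K) (borel_sl2 A).
Proof.
exact: (env_liftE (@env_scalar_comm _ _ (@sl2_br K)) (@borel_sl2D K)
  (@borel_sl2Z K) (@borel_sl2_br K)).
Qed.
Lemma Uincl_scalar (c : K) :
  Uincl K (env_scalar (@borel_br K) c) = env_scalar (@sl2_br K) c.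
Proof.
exact: (env_liftE (@env_scalar_comm _ _ (@sl2_br K)) (@borel_sl2D K)
  (@borel_sl2Z K) (@borel_sl2_br K)).
Qed.
Lemma Uchar_gen (A : borel K) : Uchar mu (env_gen (@borel_br K) A) = borel_char mu A.
Proof.
exact: (env_liftE (@borel_charC K) (borel_charD mu) (borel_charZ mu) (borel_char_br mu)).
Qed.
Lemma Uchar_scalar (c : K) : Uchar mu (env_scalar (@borel_br K) c) = c.
Proof.
exact: (env_liftE (@borel_charC K) (borel_charD mu) (borel_charZ mu) (borel_char_br mu)).
Qed.

Lemma borel_act_hw (A : borel K) :
  gact (borel_sl2 A) verma_hw = borel_char mu A *: verma_hw.
Proof.
(* The scalar is also written as an element of U(b), so that both sides move across the tensor sign
   and are compared in [Cmu mu]. *)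
suff E : Uincl K (env_gen (@borel_br K) A) *: (verma_hw : extscal (Uincl K) (Cmu mu)) =
    Uincl K (env_scalar (@borel_br K) (borel_char mu A)) *: (verma_hw : extscal _ _).
  by rewrite Uincl_gen Uincl_scalar in E; exact: E.
rewrite !tens_balanced; congr tens.
suff E : Uchar mu (env_gen (@borel_br K) A) * 1 =
  Uchar mu (env_scalar (@borel_br K) (borel_char mu A)) * 1 by exact: E.
by rewrite Uchar_gen Uchar_scalar.
Qed.

Fact borel_H_subproof : mxH K \in @borel_pred K.
Proof. by rewrite unfold_in mxtrace2 !mxE /= subr0 sub0r !subrr eqxx. Qed.
Fact borel_E_subproof : (delta_mx 0 1 : 'M[K]_2) \in @borel_pred K.
Proof. by rewrite unfold_in mxtrace2 !mxE /= addr0 eqxx. Qed.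

Lemma gact0r (N : gmod K) x : gact x (0 : N) = 0.
Proof. by rewrite -[X in gact x X](scale0r (0 : N)) gactZr scale0r. Qed.

Lemma verma_H k : gact (sl2_H K) (verma_vec k) = (mu - k%:R *+ 2) *: verma_vec k.
Proof.
elim: k => [|k IHk].
  rewrite -[sl2_H K](_ : borel_sl2 (Borel borel_H_subproof) = _); last exact/val_inj.
  rewrite borel_act_hw /borel_char /= !mxE /=; congr (_ *: _).
  by rewrite mul0rn !subr0 mulr1.
rewrite /verma_vec iterS -/(verma_vec k).
rewrite (weight_F (la := mu - k%:R *+ 2)) //.
by congr (_ *: _); ring.
Qed.

Lemma sl2_brEF : sl2_br (sl2_E K) (sl2_F K) = sl2_H K.
Proof.
by apply/val_inj/mx2P; rewrite /= /mxbr [LHS]mxE [X in _ + X]mxE !mulmx2 !mxE /=; ring.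
Qed.

Lemma verma_E0 : gact (sl2_E K) verma_hw = 0.
Proof.
rewrite -[sl2_E K](_ : borel_sl2 (Borel borel_E_subproof) = _); last exact/val_inj.
by rewrite borel_act_hw /borel_char /= !mxE /= mulr0 scale0r.
Qed.

(** Induction on [k] through [E F = F E + H]; [E] kills the generator and [H] acts on each vector by
    a scalar. *)
Lemma verma_E k : exists c, gact (sl2_E K) (verma_vec k.+1) = c *: verma_vec k.
Proof.
have E j : gact (sl2_E K) (verma_vec j.+1) =
    gact (sl2_F K) (gact (sl2_E K) (verma_vec j)) + gact (sl2_H K) (verma_vec j).
  by rewrite -sl2_brEF gact_br addrC subrK.
elim: k => [|k [c IHk]].
  by exists (mu - 0%:R *+ 2); rewrite E verma_E0 gact0r add0r verma_H.
exists (c + (mu - k.+1%:R *+ 2)).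
by rewrite E IHk gactZr verma_H scalerDl.
Qed.

(* The vectors annihilated by every linear form vanishing on all verma_vec k
   form a g-submodule containing the generator. *)
Lemma verma_form_eq0 (D : M -> K) :
  (forall c m m', D (c *: m + m') = c * D m + D m') ->
  (forall k, D (verma_vec k) = 0) -> forall m, D m = 0.
Proof.
pose lin (D : M -> K) := forall c m m', D (c *: m + m') = c * D m + D m'.
have lin0 D' : lin D' -> D' 0 = 0.
  by move=> h; have := h (-1) 0 0; rewrite scaler0 addr0 mulN1r addNr.
have linZ D' : lin D' -> forall c m, D' (c *: m) = c * D' m.
  by move=> h c m; rewrite -[c *: m]addr0 h lin0 // addr0.
have linD D' : lin D' -> forall m m', D' (m + m') = D' m + D' m'.
  by move=> h m m'; rewrite -[m]scale1r h mul1r scale1r.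
pose S m := forall D, lin D -> (forall k, D (verma_vec k) = 0) -> D m = 0.
suff H m : S m by move=> Dlin Dv m; exact: H.
have SD m1 m2 : S m1 -> S m2 -> S (m1 + m2).
  by move=> h1 h2 D' h h'; rewrite linD // h1 // h2 // addr0.
have SZ c m1 : S m1 -> S (c *: m1).
  by move=> h1 D' h h'; rewrite linZ // h1 // mulr0.
have SG x m1 : S m1 -> S (gact x m1).
  (* [S] quantifies over all forms, so it applies to [D'] composed with [x], which again vanishes on
     every [verma_vec k]. *)
  move=> h1 D' h h'; apply: (h1 (fun m => D' (gact x m))).
    by move=> c u v; rewrite gactDr gactZr h.
  move=> k; rewrite (sl2_decomp x) !(gactDl, gactZl) !(linD, linZ) //.
  rewrite verma_H linZ // h' !mulr0 add0r.
  rewrite (_ : gact (sl2_F K) _ = verma_vec k.+1) // h' mulr0 addr0.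
  case: k => [|k]; first by rewrite verma_E0 lin0 // mulr0.
  by have [c ->] := verma_E k; rewrite linZ // h' !mulr0.
have SU (u : Usl2 K) m1 : S m1 -> S (u *: (m1 : extscal _ _)).
  elim/env_ind: u m1; elim=> [c|x|u IHu v IHv|u IHu v IHv] m1 h1.
  - exact: (SZ c m1 h1).
  - exact: (SG x m1 h1).
  - by rewrite env_piD scalerDl; apply: SD; [apply: IHu|apply: IHv].
  - by rewrite env_piM -scalerA; apply: IHu; apply: IHv.
elim/ext_ind: m; elim=> [|u q|x hx y hy|x hx].
- by move=> D' h _; rewrite lin0.
- rewrite (_ : ext_pi _ _ = u *: tens (Uincl K) 1 q); last by rewrite tensZ mulr1.
  apply: (SU).
  (* The coefficient [q] is a scalar of U(b) applied to [1], hence moves to the left factor. *)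
  have -> : q = env_scalar (@borel_br K) q *: (1 : Cmu mu).
    suff E : (q : K) = Uchar mu (env_scalar (@borel_br K) q) * 1 by exact: E.
    by rewrite Uchar_scalar mulr1.
  rewrite -tens_balanced; apply: (SU).
  by move=> D' _ h; apply: (h 0%N).
- by rewrite ext_piD; apply: SD.
- rewrite ext_piN (_ : - _ = (-1 : K) *: (ext_pi (Uincl K) x : M)).
    exact: SZ.
  by rewrite scaleN1r.
Qed.

End VermaBasis.

(** * The right action of U(g) through the transpose *)

Section TransposedAction.
Variables (K : fieldType) (M : gmod K).

(* The right action of the enveloping algebra obtained from the left action on
   M by means of the anti-automorphism sl2_tr. *)
Fixpoint uterm_tract (u : uterm (sl2 K)) (m : M) : M :=
  match u with
  | Ucst c => c *: m
  | Ugen x => gact (sl2_tr x) m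
  | Uadd u v => uterm_tract u m + uterm_tract v m
  | Umul u v => uterm_tract v (uterm_tract u m)
  end.

Lemma sl2_trD (x y : sl2 K) : sl2_tr (x + y) = sl2_tr x + sl2_tr y.
Proof. by apply/val_inj; rewrite /= linearD. Qed.
Lemma sl2_trZ c (x : sl2 K) : sl2_tr (c *: x) = c *: sl2_tr x.
Proof. by apply/val_inj; rewrite /= linearZ. Qed.
Lemma sl2_tr_br (x y : sl2 K) : sl2_tr (sl2_br x y) = sl2_br (sl2_tr y) (sl2_tr x).
Proof. by apply/val_inj; rewrite /= /mxbr linearB /= !trmx_mul. Qed.
Lemma sl2_tr_F : sl2_tr (sl2_F K) = sl2_E K.
Proof. by apply/val_inj; rewrite /= trmx_delta. Qed.
Lemma sl2_tr_H : sl2_tr (sl2_H K) = sl2_H K.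
Proof. by apply/val_inj; rewrite /= /mxH linearB /= !trmx_delta. Qed.

Lemma uterm_tractD u m m' :
  uterm_tract u (m + m') = uterm_tract u m + uterm_tract u m'.
Proof.
elim: u m m' => [c|x|u IHu v IHv|u IHu v IHv] m m' /=.
- by rewrite scalerDr.
- by rewrite gactDr.
- by rewrite IHu IHv addrACA.
- by rewrite IHu IHv.
Qed.
Lemma uterm_tractZ u c m : uterm_tract u (c *: m) = c *: uterm_tract u m.
Proof.
elim: u m => [d|x|u IHu v IHv|u IHu v IHv] m /=.
- by rewrite !scalerA mulrC.
- by rewrite gactZr.
- by rewrite IHu IHv scalerDr.
- by rewrite IHu IHv.
Qed.

(** The transpose reverses brackets and [uterm_tract] reverses products, so each defining relation
    of U(g) is respected and the right action descends to U(g). *)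
Lemma uterm_tract_eq u v : uterm_eq (@sl2_br K) u v ->
  forall m, uterm_tract u m = uterm_tract v m.
Proof.
elim=> {u v} /=; try by [].
- by move=> u v w _ h _ k m; rewrite h k.
- by move=> u u' v v' _ h _ k m; rewrite h k.
- by move=> u u' v v' _ h _ k m; rewrite h k.
- by move=> u v w m; rewrite addrA.
- by move=> u v m; rewrite addrC.
- by move=> u m; rewrite scale0r add0r.
- by move=> u m; rewrite scale1r.
- by move=> u m; rewrite scale1r.
- by move=> u m; rewrite uterm_tractZ !scale0r.
- by move=> u v w m; rewrite uterm_tractD.
- by move=> c d m; rewrite scalerDl.
- by move=> c d m; rewrite scalerA mulrC.
- by move=> c u m; rewrite uterm_tractZ.
- by move=> x y m; rewrite sl2_trD gactDl.
- by move=> c x m; rewrite sl2_trZ gactZl gactZr.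
- by move=> x y m; rewrite sl2_tr_br gact_br !gactZr scaleN1r.
Qed.

Lemma uterm_tract_repr u m :
  uterm_tract (repr (env_pi (@sl2_br K) u)) m = uterm_tract u m.
Proof. exact: uterm_tract_eq (env_reprE _ _) m. Qed.

End TransposedAction.

(** * The contravariant pairing with the Verma module defined by a form [ell] *)

Section HighestWeightForm.
Variables (K : fieldType) (mu : K) (M : gmod K) (ell : M -> K).
Hypothesis ell_linear : forall c m m', ell (c *: m + m') = c * ell m + ell m'.
Hypothesis ell_F : forall m, ell (gact (sl2_F K) m) = 0.
Hypothesis ell_H : forall m, ell (gact (sl2_H K) m) = mu * ell m.

Lemma formD m m' : ell (m + m') = ell m + ell m'.
Proof. by rewrite -[m]scale1r ell_linear mul1r scale1r. Qed.
Lemma form0 : ell 0 = 0.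
Proof. by apply: (addrI (ell 0)); rewrite -formD !addr0. Qed.
Lemma formZ c m : ell (c *: m) = c * ell m.
Proof. by rewrite -[c *: m]addr0 ell_linear form0 addr0. Qed.

(** The pairing on formal tensors, before the quotient; by [uterm_tract_repr] the representative
    chosen for [u] does not matter. *)
Fixpoint tterm_pair (x : tterm (Usl2 K) (Cmu mu)) (m : M) : K :=
  match x with
  | Tzero => 0
  | Ttens u c => (c : K) * ell (uterm_tract (repr u) m)
  | Tadd x y => tterm_pair x m + tterm_pair y m
  | Topp x => - tterm_pair x m
  end.

(** The transpose of an element of b has no [E] component, so [ell_F] and [ell_H] determine the
    value. *)
Lemma form_borel (A : borel K) m :
  ell (gact (sl2_tr (borel_sl2 A)) m) = borel_char mu A * ell m.
Proof.
rewrite (sl2_decomp (sl2_tr _)) !(gactDl, gactZl) !(formD, formZ) ell_F ell_H.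
by rewrite /= !mxE borel_low /borel_char; ring.
Qed.

(** Extends [form_borel] from b to U(b) by induction on terms; this is the compatibility that the
    balanced relation of the tensor product asks for. *)
Lemma form_Uborel (b : Uborel K) m :
  ell (uterm_tract (repr (Uincl K b)) m) = Uchar mu b * ell m.
Proof.
elim/env_ind: b m => u.
pose tr (u : Usl2 K) m := uterm_tract (repr u) m : M.
have trE u' m : tr (env_pi (@sl2_br K) u') m = uterm_tract u' m.
  exact: uterm_tract_repr.
suff E m : ell (tr (Uincl K (env_pi (@borel_br K) u)) m) =
    Uchar mu (env_pi (@borel_br K) u) * ell m by [].
elim: u m => [c|x|u IHu v IHv|u IHu v IHv] m.
- by rewrite (Uincl_scalar c) (Uchar_scalar mu c) trE formZ.
- by rewrite (Uincl_gen x) (Uchar_gen mu x) trE form_borel.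
- rewrite env_piD !rmorphD mulrDl -IHu -IHv -formD.
  elim/env_ind: (Uincl K _) => a; elim/env_ind: (Uincl K _) => a'.
  by rewrite -env_piD !trE.
- rewrite env_piM !rmorphM [X in X * ell m]mulrC -mulrA -IHu -IHv.
  elim/env_ind: (Uincl K _) => a; elim/env_ind: (Uincl K _) => a'.
  by rewrite -env_piM !trE.
Qed.

(** The pairing descends to the tensor product: additivity in [u] follows from that of [ell], and
    the balanced relation is [form_Uborel]. *)
Lemma tterm_pair_eq x y : tterm_eq (Uincl K) x y ->
  forall m, tterm_pair x m = tterm_pair y m.
Proof.
elim=> {x y} /=; try by [].
- by move=> x y z _ h _ k m; rewrite h k.
- by move=> x x' y y' _ h _ k m; rewrite h k.
- by move=> x x' _ h m; rewrite h.
- by move=> x y z m; rewrite addrA.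
- by move=> x y m; rewrite addrC.
- by move=> x m; rewrite add0r.
- by move=> x m; rewrite addNr.
- move=> a a' q m; elim/env_ind: a => a; elim/env_ind: a' => a'.
  by rewrite -env_piD !uterm_tract_repr /= formD mulrDr.
- by move=> a q q' m; rewrite mulrDl.
- move=> a b q m.
  suff E : (q : K) * ell (uterm_tract (repr (a * Uincl K b)) m) =
      (Uchar mu b * (q : K)) * ell (uterm_tract (repr a) m) by exact: E.
  have := form_Uborel b.
  move: (Uincl K b) => b'; elim/env_ind: a => a; elim/env_ind: b' => b' h.
  rewrite -env_piM !uterm_tract_repr /=.
  have := h (uterm_tract a m); rewrite uterm_tract_repr => ->.
  by rewrite mulrCA mulrA.
Qed.

Definition verma_pair (m : M) (v : verma mu) : K := tterm_pair (repr (v : extscal _ _)) m.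

Lemma verma_pairE m x : verma_pair m (ext_pi (Uincl K) x) = tterm_pair x m.
Proof. by apply: tterm_pair_eq; exact: ext_reprE. Qed.

Lemma verma_pair_linear m c v v' :
  verma_pair m (c *: v + v') = c * verma_pair m v + verma_pair m v'.
Proof.
have D x x' : verma_pair m (x + x') = verma_pair m x + verma_pair m x'.
  elim/ext_ind: x => x; elim/ext_ind: x' => x'.
  by rewrite -ext_piD !verma_pairE.
rewrite D; congr (_ + _); elim/ext_ind: v => x.
suff E : verma_pair m (env_scalar (@sl2_br K) c *: ext_pi (Uincl K) x) =
    c * verma_pair m (ext_pi (Uincl K) x) by exact: E.
rewrite [_ *: _]ext_scaleE !verma_pairE.
elim: x => /= [|u q|x -> y ->|x ->]; rewrite ?mulr0 ?mulrDr ?mulrN //.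
rewrite [RHS]mulrCA; congr (_ * _); rewrite -formZ -uterm_tractZ; congr ell.
elim/env_ind: u => u; rewrite -env_piM.
by rewrite !uterm_tract_repr.
Qed.

Lemma verma_pairZr m c v : verma_pair m (c *: v) = c * verma_pair m v.
Proof.
have p0 : verma_pair m 0 = 0 by exact: (verma_pairE m (Tzero _ _)).
by rewrite -[c *: v]addr0 verma_pair_linear p0 addr0.
Qed.

Lemma verma_pairDl m m' v : verma_pair (m + m') v = verma_pair m v + verma_pair m' v.
Proof.
elim/ext_ind: v => x; rewrite !verma_pairE.
elim: x => /= [|u q|x -> y ->|x ->]; rewrite ?addr0 ?opprD //; last by rewrite addrACA.
by rewrite uterm_tractD formD mulrDr.
Qed.
Lemma verma_pairZl c m v : verma_pair (c *: m) v = c * verma_pair m v.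
Proof.
elim/ext_ind: v => x; rewrite !verma_pairE.
elim: x => /= [|u q|x -> y ->|x ->]; rewrite ?mulr0 ?mulrDr ?mulrN //.
by rewrite uterm_tractZ formZ mulrCA.
Qed.

(** Multiplying [u] on the left by [x] makes [sl2_tr x] act first on [m]. *)
Lemma verma_pair_act x m v :
  verma_pair m (gact x v) = verma_pair (gact (sl2_tr x) m) v.
Proof.
elim/ext_ind: v => y.
suff E : verma_pair m (env_gen (@sl2_br K) x *: ext_pi (Uincl K) y) =
    verma_pair (gact (sl2_tr x) m) (ext_pi (Uincl K) y) by exact: E.
rewrite [_ *: _]ext_scaleE !verma_pairE.
elim: y => /= [|u q|y -> z ->|y ->] //.
congr (_ * ell _); elim/env_ind: u => u; rewrite -env_piM.
by rewrite !uterm_tract_repr.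
Qed.

Lemma verma_pair_hw m : verma_pair m (verma_hw mu) = ell m.
Proof.
rewrite /verma_hw [LHS]verma_pairE /= mul1r.
by rewrite uterm_tract_repr /= scale1r.
Qed.

Lemma verma_pair_vec m k :
  verma_pair m (verma_vec mu k) = ell (iter k (gact (sl2_E K)) m).
Proof.
elim: k m => [|k IHk] m; first exact: verma_pair_hw.
by rewrite /verma_vec iterS verma_pair_act sl2_tr_F IHk iterSr.
Qed.

End HighestWeightForm.

(** * A criterion for a g-module to be a dual Verma module *)

Section DualVermaCriterion.
Variables (K : numFieldType) (mu : K) (M : gmod K) (ell : M -> K) (w : nat -> M).
Hypothesis ell_linear : forall c m m', ell (c *: m + m') = c * ell m + ell m'.
Hypothesis ell_w : forall k, ell (w k) = (k == 0%N)%:R.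
Hypothesis w_span : forall m, exists N (a : nat -> K), m = \sum_(k < N) a k *: w k.
Hypothesis w_E : forall k, gact (sl2_E K) (w k) = (- k%:R) *: w k.-1.
Hypothesis w_H : forall k, gact (sl2_H K) (w k) = (mu - k%:R *+ 2) *: w k.
Hypothesis w_F : forall k, ell (gact (sl2_F K) (w k)) = 0.

Let ellD m m' : ell (m + m') = ell m + ell m'.
Proof. exact: formD. Qed.
Let ell0 : ell 0 = 0.
Proof. exact: form0. Qed.
Let ellZ c m : ell (c *: m) = c * ell m.
Proof. exact: formZ. Qed.

Lemma span_ind (P : M -> Prop) : P 0 -> (forall m m', P m -> P m' -> P (m + m')) ->
  (forall c k, P (c *: w k)) -> forall m, P m.
Proof.
move=> P0 PD PZ m; have [N [a ->]] := w_span m.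
by elim/big_ind: _ => // k _; exact: PZ.
Qed.

Lemma span_ell_F m : ell (gact (sl2_F K) m) = 0.
Proof.
elim/span_ind: m => [|m m' h h'|c k].
- by rewrite gact0r ell0.
- by rewrite gactDr ellD h h' addr0.
- by rewrite gactZr ellZ w_F mulr0.
Qed.
Lemma span_ell_H m : ell (gact (sl2_H K) m) = mu * ell m.
Proof.
elim/span_ind: m => [|m m' h h'|c k].
- by rewrite gact0r ell0 mulr0.
- by rewrite gactDr !ellD h h' mulrDr.
- rewrite gactZr w_H !ellZ ell_w; case: k => [|k]; last by rewrite !mulr0.
  by rewrite mul0rn subr0 !mulr1 mulrC.
Qed.

Let pair := @verma_pair K mu M ell.
Let pair_linear := verma_pair_linear ell_linear span_ell_F span_ell_H.
Let pairD := verma_pairDl ell_linear span_ell_F span_ell_H.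
Let pairZ := verma_pairZl ell_linear span_ell_F span_ell_H.
Let pairZr := verma_pairZr ell_linear span_ell_F span_ell_H.
Let pair_act := verma_pair_act ell_linear span_ell_F span_ell_H.
Let pair_vec := verma_pair_vec ell_linear span_ell_F span_ell_H.

(** [E^j] takes [w k] to a multiple of [w (k - j)], or to 0 when [j > k], and [ell] sees only [w 0].
    The diagonal entries are nonzero in characteristic 0. *)
Lemma pair_w_vec k j : pair (w k) (verma_vec mu j) =
  if k == j then (-1) ^+ k * (k`!)%:R else 0.
Proof.
rewrite /pair pair_vec.
have itZ i c m : iter i (gact (sl2_E K)) (c *: m) = c *: iter i (gact (sl2_E K)) m.
  by elim: i => //= i ->; rewrite gactZr.
elim: j k => [|j IHj] [|k].
- by rewrite /= ell_w expr0 mulr1.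
- by rewrite /= ell_w.
(* Here [0.-1] is [0], but the coefficient [- 0] kills the vector. *)
- by rewrite iterSr w_E oppr0 scale0r -(scale0r 0) itZ ellZ mul0r.
- rewrite iterSr w_E itZ ellZ IHj eqSS /=; case: eqP => // _; last by rewrite mulr0.
  by rewrite exprS factS natrM; ring.
Qed.

Lemma pair_sum_vec N (a : nat -> K) j :
  pair (\sum_(k < N) a k *: w k) (verma_vec mu j) =
  if (j < N)%N then a j * ((-1) ^+ j * (j`!)%:R) else 0.
Proof.
elim: N => [|N IHN].
  by rewrite big_ord0 -(scale0r 0) /pair pairZ mul0r.
rewrite big_ord_recr /= /pair pairD pairZ -/pair IHN pair_w_vec ltnS.
case: ltngtP => h; rewrite ?mulr0 ?addr0 //.
by rewrite h add0r.
Qed.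

(** [H] is fixed by the transpose, hence self-adjoint for the pairing, so distinct weights are
    orthogonal. *)
Lemma pair_weight k la v : weight_space la v -> la != mu - k%:R *+ 2 -> pair (w k) v = 0.
Proof.
rewrite /weight_space /= => vH h.
have : la * pair (w k) v = (mu - k%:R *+ 2) * pair (w k) v.
  have vE : gact (sl2_H K) v = la *: v by exact: vH.
  by rewrite /pair -[RHS]pairZ -w_H -[in RHS]sl2_tr_H -pair_act vE pairZr.
move/eqP; rewrite -subr_eq0 -mulrBl mulf_eq0 subr_eq0 (negPf h) /=.
by move/eqP.
Qed.

Fact pair_cdual m : (pair m : verma mu -> K^o) \in @cdual_pred K (verma mu).
Proof.
apply/asboolP; split; first exact: pair_linear.
have [N [a ->]] := w_span m.
(* These are the weights of the [w k] that occur in [m]. *)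
exists [seq mu - k%:R *+ 2 | k <- iota 0 N] => la las v lav.
rewrite /pair; elim: N las => [|N IHN] las.
  by rewrite big_ord0 -(scale0r 0) pairZ mul0r.
rewrite big_ord_recr /= pairD pairZ IHN ?add0r.
  rewrite -/pair (pair_weight lav) ?mulr0 //.
  apply: contra las => /eqP ->; apply/mapP; exists N => //.
  by rewrite mem_iota /= add0n.
apply: contra las => /mapP[k]; rewrite mem_iota => /andP[_ kN] ->.
by apply/mapP; exists k => //; rewrite mem_iota /= ltnS ltnW.
Qed.
Definition dual_verma_map (m : M) : dual_verma mu := CDual (pair_cdual m).

Fact dual_verma_map_linear c m m' :
  dual_verma_map (c *: m + m') = c *: dual_verma_map m + dual_verma_map m'.
Proof.
apply/val_inj/funext => v.
suff E : pair (c *: m + m') v = c * pair m v + pair m' v by exact: E.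
by rewrite /pair pairD pairZ.
Qed.
HB.instance Definition _ := GRing.isLinear.Build K M (dual_verma mu) *:%R
  dual_verma_map dual_verma_map_linear.

Lemma dual_verma_map_inj : injective dual_verma_map.
Proof.
move=> m m' h; apply/eqP; rewrite -subr_eq0; apply/eqP.
have {h} : dual_verma_map (m - m') = 0 by rewrite raddfB /= h subrr.
move: (m - m') => {m'}m h.
have p0 v : pair m v = 0.
  exact: (congr1 (fun f : cdual_sort (verma mu) => f v) h).
have [N [a mE]] := w_span m; rewrite mE big1 // => k _.
(* Pairing with [verma_vec mu k] reads off [a k] up to the nonzero factor [(-1)^k k!]. *)
have := p0 (verma_vec mu k); rewrite mE pair_sum_vec ltn_ord.
move/eqP; rewrite !mulf_eq0 signr_eq0 pnatr_eq0 -[_ == 0%N]negbK -lt0n fact_gt0.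
by rewrite !orbF => /eqP ->; rewrite scale0r.
Qed.

(** A form in the contragredient dual vanishes on almost all [verma_vec mu k]; a combination of the
    [w k] matches its other values, and [verma_form_eq0] shows that these values determine the
    form. *)
Lemma dual_verma_map_surj (f : cdual_sort (verma mu)) : exists m, dual_verma_map m = f.
Proof.
case: f => g gP.
have /asboolP[glin [s sP]] := gP.
(* The weights [mu - 2k] are pairwise distinct, so the finite list [s] contains only finitely many
   of them. *)
have [N NP] : exists N, forall k, (N <= k)%N -> mu - k%:R *+ 2 \notin s.
  elim: s {sP} => [|x s [N NP]]; first by exists 0%N.
  have [[k0 k0E]|nx] := pselect (exists k, x = mu - k%:R *+ 2).
    exists (maxn N k0.+1) => k; rewrite geq_max => /andP[Nk k0k].
    rewrite inE negb_or NP // andbT k0E (inj_eq (addrI _)) eqr_opp.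
    by rewrite -!mulrnA eqr_nat eqn_mul2r /= gtn_eqF.
  exists N => k Nk; rewrite inE negb_or NP // andbT.
  by apply/eqP => kx; apply: nx; exists k.
have gv k : (N <= k)%N -> g (verma_vec mu k) = 0.
  by move=> Nk; apply: (sP _ (NP _ Nk)); exact: verma_H.
(* Division by the diagonal entry of the pairing. *)
pose a k : K := g (verma_vec mu k) / ((-1) ^+ k * (k`!)%:R).
exists (\sum_(k < N) a k *: w k).
apply/val_inj/funext => v.
apply/eqP; rewrite -subr_eq0; apply/eqP.
apply: (@verma_form_eq0 K mu (fun v => pair (\sum_(k < N) a k *: w k) v - g v)).
  by move=> c v1 v2; rewrite /pair pair_linear glin; ring.
move=> k; rewrite pair_sum_vec; case: ltnP => kN; last by rewrite gv // subrr.
rewrite /a divfK ?subrr // mulf_eq0 signr_eq0 pnatr_eq0.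
by rewrite -lt0n fact_gt0.
Qed.

(** Equivariance is the contravariance of the pairing, the transpose being an involution. *)
Lemma dual_verma_criterion : gmod_iso M (dual_verma mu).
Proof.
exists dual_verma_map.
  have [g gK] := choice dual_verma_map_surj.
  by exists g => // m; apply: dual_verma_map_inj; rewrite gK.
move=> x m; apply/val_inj/funext => v.
suff E : pair (gact x m) v = pair m (gact (sl2_tr x) v) by exact: E.
rewrite /pair pair_act; congr (verma_pair _ (gact _ _) _).
by apply/val_inj; rewrite /= trmxK.
Qed.

End DualVermaCriterion.

(** * Regular functions on the affine line are polynomials *)

Section AffineLine.
Variable K : closedFieldType.

Lemma horner_eq0 (P : {poly K}) : (forall x, P.[x] = 0) -> P = 0.
Proof.
move=> P0; apply/eqP; apply: contraT => /closed_nonrootP[x].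
by rewrite rootE P0 eqxx.
Qed.

(* Among the representations of f as a fraction, one with denominator of minimal
   degree has no pole: at a zero a of the denominator, comparing with a fraction
   defined at a shows that numerator and denominator share the factor X - a. *)
Lemma locally_fraction_poly (f : K -> K) :
  (forall a, exists P Q : {poly K}, Q.[a] != 0 /\
     forall x, Q.[x] != 0 -> f x = P.[x] / Q.[x]) ->
  exists P : {poly K}, forall x, f x = P.[x].
Proof.
move=> floc.
suff H n (P Q : {poly K}) : (size Q <= n)%N -> Q != 0 ->
    (forall x, Q.[x] != 0 -> f x = P.[x] / Q.[x]) ->
    exists P : {poly K}, forall x, f x = P.[x].
  have [P [Q [Q0 PQ]]] := floc 0; apply: (H _ P Q (leqnn _)) => //.
  by apply: contraNneq Q0 => ->; rewrite horner0.
elim: n P Q => [|n IHn] P Q; first by rewrite leqn0 size_poly_eq0 => /eqP ->; rewrite eqxx.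
move=> sQ Q0 PQ.
have [/size_poly1P[c c0 QE]|] := boolP (size Q == 1%N).
  by exists (c^-1 *: P) => x; rewrite PQ QE hornerC // hornerZ mulrC.
move=> /closed_rootP[a Qa].
have [P' [Q' [Q'a PQ']]] := floc a.
have E : P * Q' = P' * Q.
  have Q'0 : Q' != 0 by apply: contraNneq Q'a => ->; rewrite horner0.
  (* The factor [Q * Q'] makes the identity hold also at zeros of the denominators, where the
     fractions say nothing about [f]. *)
  suff /eqP : Q * (Q' * (P * Q' - P' * Q)) = 0.
    by rewrite !mulf_eq0 (negPf Q0) (negPf Q'0) subr_eq0 => /eqP.
  apply: horner_eq0 => x; rewrite !hornerM hornerD hornerN !hornerM.
  have [->|Qx] := eqVneq Q.[x] 0; first by rewrite mul0r.
  have [->|Q'x] := eqVneq Q'.[x] 0; first by rewrite mul0r mulr0.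
  have := PQ' x Q'x; rewrite (PQ x Qx) => /eqP.
  by rewrite eqr_div // => /eqP ->; rewrite subrr !mulr0.
have Pa : root P a.
  have := congr1 (horner^~ a) E; rewrite /= !hornerM (rootP Qa) mulr0 => /eqP.
  by rewrite mulf_eq0 (negPf Q'a) orbF.
have [P1 PE] := factor_theorem P a Pa; have [Q1 QE] := factor_theorem Q a Qa.
have X0 : 'X - a%:P != 0 :> {poly K} by rewrite polyXsubC_eq0.
have Q10 : Q1 != 0 by apply: contraNneq Q0 => Q10; rewrite QE Q10 mul0r.
apply: (IHn P1 Q1) => //.
  by move: sQ; rewrite QE size_Mmonic ?monicXsubC // size_XsubC addn2.
have E1 : P1 * Q' = P' * Q1.
  by apply: (mulIf X0); rewrite mulrAC -PE E QE mulrA.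
(* At [a] the fraction [P / Q] gives no value of [f]; the fraction [P' / Q'] does. *)
move=> x Q1x; have [xa|xa] := eqVneq x a.
  rewrite xa in Q1x *; rewrite PQ' //; apply/eqP; rewrite eqr_div //.
  by rewrite -!hornerM E1.
have Xx : x - a != 0 by rewrite subr_eq0.
rewrite PQ QE !hornerE; last by rewrite mulf_neq0.
by rewrite PE !hornerE -mulf_div divff // mulr1.
Qed.

End AffineLine.

(** * Lie derivatives of powers *)

Section LieDerivativeOfMonomials.
Variables (K : numClosedFieldType) (xi : 'M[K]_2) (U : opn K).
Local Notation V := 'cV[K]_2.

Lemma lie_derive_coord i v : lie_derive xi (fun u => u i 0) v =
  - (xi i 0 * v 0 0 + xi i 1 * v 1 0).
Proof. by rewrite /lie_derive derive_coord mxE mulmx2. Qed.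

Lemma polyfun_regular (A : set V) p : polyfun p -> regular_on A p.
Proof.
move=> pp v _; exists p, (fun=> 1); split=> //.
  exact: polyfun_cst.
by move=> u _ _; rewrite divr1.
Qed.

Lemma lie_derive_exp p k v : polyfun p -> cone U v ->
  lie_derive xi (fun u => p u ^+ k) v = k%:R * p v ^+ k.-1 * lie_derive xi p v.
Proof.
move=> pp Uv; elim: k => [|k IHk].
  rewrite (_ : (fun _ => _) = fun=> 1); last by apply/funext => u; rewrite expr0.
  by rewrite lie_polyC !mul0r.
rewrite (_ : (fun _ => _) = fun u => p u * p u ^+ k); last first.
  by apply/funext => u; rewrite exprS.
rewrite lie_polyM //; last exact: polyfun_exp.
rewrite IHk /=; case: k {IHk} => [|k] /=; first by ring.
by rewrite exprS -[k.+2%:R]natr1; ring.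
Qed.

Lemma lie_derive_expz p (m : int) v : polyfun p -> (forall u, cone U u -> p u != 0) ->
  cone U v ->
  lie_derive xi (fun u => p u ^ m) v = m%:~R * p v ^ (m - 1) * lie_derive xi p v.
Proof.
move=> pp pU Uv; have pv := pU v Uv; case: m => k.
  rewrite [LHS](lie_derive_exp k pp Uv); case: k => [|k]; first by rewrite !mul0r.
  by rewrite -[_ - 1](_ : k = _ :> int) // -addn1 PoszD addrK.
(* For a negative exponent, differentiate the product with the inverse power, which is 1 on the
   cone, and solve for the unknown term. *)
have : lie_derive xi (fun u => p u ^ Negz k * p u ^+ k.+1) v = 0.
  rewrite -(lie_polyC xi 1 v); apply: (lie_derive_local _ Uv) => u Uu.
  by rewrite NegzE -exprnN mulVf // expf_neq0 // pU.
rewrite (lie_deriveM xi _ _ Uv) //; last 2 first.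
- exact: regular_expz.
- by apply/polyfun_regular/polyfun_exp.
move/eqP; rewrite addrC addr_eq0 (lie_derive_exp k.+1 pp Uv) => /eqP E.
have pk : p v ^+ k.+1 != 0 by rewrite expf_neq0.
apply: (mulfI pk); rewrite E /= NegzE rmorphN /=.
have -> : p v ^ (- k.+1%:Z - 1) = (p v ^+ k.+2)^-1.
  by rewrite exprnN -opprD -PoszD addn1.
rewrite -pmulrn -exprnN !exprS; field.
by rewrite pv expf_neq0.
Qed.

End LieDerivativeOfMonomials.

(** * The global sections as the g-module C[w] *)

Section GlobalSections.
Variables (K : numClosedFieldType) (t : int).
Local Notation V := 'cV[K]_2.
Let W : opn K := opnI (opnT K) (Uinf K).
Let G := global_sections (I_Uinf K t).

(** Unfolding the direct image and the pullback, a global section is a regular function of degree 0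
    on the cone of [W], that is, a function of [w = v 0 0 / v 1 0]. *)
Definition gs_fun (q : G) : V -> K := (q : sect 0 W).

Lemma cone_W v : cone W v <-> v 1 0 != 0.
Proof.
rewrite -(cone_Uinf v); split=> [/coneI[]//|h].
by apply/coneI; split=> //; apply/coneT; exact: cone_neq0 h.
Qed.

Lemma gs_funP (q q' : G) : (forall v : V, v 1 0 != 0 -> gs_fun q v = gs_fun q' v) -> q = q'.
Proof. by move=> h; apply: (@sectP K 0 W) => v /cone_W; exact: h. Qed.

Lemma gs_funD (q q' : G) v : gs_fun (q + q') v = gs_fun q v + gs_fun q' v.
Proof. by []. Qed.

(** A scalar acts as a constant operator on O(t - 1) conjugated by the trivialization; the powers of
    [v 1 0] cancel. *)
Lemma gs_funZ c (q : G) v : gs_fun (c *: q) v = c * gs_fun q v.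
Proof.
have [Wv|Wv] := pselect (cone W v); last by rewrite /gs_fun !sect0 // mulr0.
have h : (W `<=` Uinf K)%classic by move=> x [].
suff E : (triv h (c *: triv_inv (t - 1) h (q : sect 0 W))) v = c * (q : sect 0 W) v.
  by exact: E.
have v1 : v 1 0 != 0 by apply/cone_W.
rewrite trivE // sectZE triv_invE // mulrCA; congr (_ * _).
by rewrite mulrA -expfzDr // addNr expr0z mul1r.
Qed.

(** The function [q] stands for the section [(v 1 0)^(t - 1) q] of O(t - 1), on which g acts by the
    Lie derivative. *)
Lemma gs_fun_act x (q : G) (v : V) : v 1 0 != 0 ->
  gs_fun (gact x q) v = v 1 0 ^ (- (t - 1)) *
    lie_derive x (fun u => u 1 0 ^ (t - 1) * gs_fun q u) v.
Proof.
move=> v1; have Wv : cone W v by apply/cone_W.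
have h : (W `<=` Uinf K)%classic by move=> y [].
suff E : (triv h (lie_sect x (triv_inv (t - 1) h (q : sect 0 W)))) v =
    v 1 0 ^ (- (t - 1)) * lie_derive x (fun u => u 1 0 ^ (t - 1) * gs_fun q u) v.
  by exact: E.
rewrite trivE // lie_sectE //; congr (_ * _).
by apply: (lie_derive_local _ Wv) => u Wu; rewrite triv_invE.
Qed.

(** The function [w^k], written homogeneously. *)
Fact gs_monomial_subproof k :
  Defs.cut W (fun v : V => v 0 0 ^+ k * v 1 0 ^ (- k%:Z)) \in sect_pred 0 W.
Proof.
apply: cut_sect => [c v c0 /cone_W v1|].
  rewrite !mxE expr0z mul1r exprMn exprzMl ?unitfE // mulrACA.
  by rewrite -exprnN divff ?mul1r // expf_neq0.
apply: regular_mul.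
  exact/polyfun_regular/polyfun_exp/polyfun_coord.
apply: regular_expz; first exact: polyfun_coord.
by move=> v /cone_W.
Qed.
Definition gs_monomial k : G := Sect (gs_monomial_subproof k).

Lemma gs_monomialE k (v : V) : v 1 0 != 0 ->
  gs_fun (gs_monomial k) v = v 0 0 ^+ k * v 1 0 ^ (- k%:Z).
Proof. by move=> v1; apply: cutE; apply/cone_W. Qed.

Lemma gs_monomial_act x k (v : V) : v 1 0 != 0 ->
  gs_fun (gact x (gs_monomial k)) v =
  ((t - 1 - k%:Z)%:~R * v 0 0 ^+ k * v 1 0 ^ (- k%:Z - 1) *
     lie_derive x (fun u => u 1 0) v +
   k%:R * v 0 0 ^+ k.-1 * v 1 0 ^ (- k%:Z) * lie_derive x (fun u => u 0 0) v).
Proof.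
move=> v1; have Wv : cone W v by apply/cone_W.
have p i : polyfun (fun u : V => u i 0) by exact: polyfun_coord.
have pW u : cone W u -> u 1 0 != 0 by move/cone_W.
rewrite gs_fun_act //.
rewrite (@lie_derive_local _ _ W _
  (fun u => u 1 0 ^ (t - 1 - k%:Z) * u 0 0 ^+ k) _ Wv); last first.
  move=> u /cone_W u1; rewrite gs_monomialE // mulrCA mulrC; congr (_ * _).
  by rewrite [RHS]expfzDr.
rewrite (lie_deriveM _ _ _ Wv); last 2 first.
- exact: regular_expz.
- exact/polyfun_regular/polyfun_exp.
rewrite (lie_derive_expz _ _ (p 1) pW Wv) (lie_derive_exp _ _ (p 0) Wv).
(* The power [(v 1 0)^(t - 1)] is split off and generalized to a nonzero [a], which cancels. *)
have -> : t - 1 - k%:Z - 1 = t - 1 + (- k%:Z - 1) by rewrite addrA.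
rewrite ![v 1 0 ^ (t - 1 + _)]expfzDr //.
have -> : v 1 0 ^ (- (t - 1)) = (v 1 0 ^ (t - 1))^-1 by rewrite invr_expz.
have := expfz_neq0 (t - 1) v1; move: (v 1 0 ^ (t - 1)) => a a0.
by field.
Qed.

(** The affine coordinate of [U_oo], lifted to the cone as [(w, 1)]. *)
Definition line_pt (x : K) : V := \col_i (if i == 0 then x else 1).

Lemma polyfun_line p : polyfun p -> exists P : {poly K}, forall x, p (line_pt x) = P.[x].
Proof.
elim=> [c|i|f g _ [P PE] _ [Q QE]|f g _ [P PE] _ [Q QE]].
- by exists c%:P => x; rewrite hornerC.
- case: (ord2P i) => ->; [exists 'X|exists 1] => x; rewrite mxE ?hornerX ?hornerC //.
- by exists (P + Q) => x; rewrite hornerD PE QE.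
- by exists (P * Q) => x; rewrite hornerM PE QE.
Qed.

(** On the line of points [(w, 1)] a section is locally a fraction, hence a polynomial, and
    homogeneity of degree 0 recovers it from its values there. *)
Lemma gs_span (q : G) : exists N (a : nat -> K), q = \sum_(k < N) a k *: gs_monomial k.
Proof.
have line_cone x : cone W (line_pt x) by apply/cone_W; rewrite mxE oner_neq0.
have [P PE] : exists P : {poly K}, forall x, gs_fun q (line_pt x) = P.[x].
  apply: locally_fraction_poly => a.
  have [p [r [/polyfun_line[P PE] /polyfun_line[Q QE] ra E]]] :=
    sect_reg (q : sect 0 W) (line_cone a).
  exists P, Q; split; first by rewrite -QE.
  by move=> x Qx; rewrite -PE -QE; apply: E; rewrite ?QE.
exists (size P), (fun k => P`_k); apply: gs_funP => v v1.
have -> : gs_fun (\sum_(k < size P) P`_k *: gs_monomial k) v =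
    \sum_(k < size P) P`_k * (v 0 0 / v 1 0) ^+ k.
  have gs0 : gs_fun 0 v = 0 by [].
  rewrite (big_morph (fun q : G => gs_fun q v) (fun a b => gs_funD a b v) gs0).
  apply: eq_bigr => k _.
  rewrite gs_funZ gs_monomialE // expr_div_n; congr (_ * (_ * _)).
  by rewrite -exprnN.
rewrite -horner_coef -PE.
have -> : line_pt (v 0 0 / v 1 0) = (v 1 0)^-1 *: v.
  apply/matrixP => i j; rewrite (ord1 j) !mxE.
  by case: (ord2P i) => -> /=; rewrite ?mulVf // mulrC.
by rewrite /gs_fun sect_homog ?invr_eq0 // expr0z mul1r.
Qed.

Lemma global_sections_I_Uinf : gmod_iso G (dual_verma ((t - 1)%:~R : K)).
Proof.
(* The form [ell] is evaluation at [w = 0]. *)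
pose e : V := line_pt 0.
have e0 : e 0 0 = 0 by rewrite mxE.
have e1 : e 1 0 = 1 by rewrite mxE.
have e1n : e 1 0 != 0 by rewrite e1 oner_neq0.
apply: (@dual_verma_criterion K _ G (fun q => gs_fun q e) gs_monomial).
- by move=> c q q'; rewrite gs_funD gs_funZ.
- by move=> k; rewrite gs_monomialE // e0 e1 exp1rz mulr1 expr0n.
- exact: gs_span.
(* [E] acts as [- d/dw]. *)
- move=> k; apply: gs_funP => v v1; rewrite gs_funZ gs_monomial_act // gs_monomialE //.
  rewrite !lie_derive_coord /= !mxE /= !mul0r !addr0 oppr0 mulr0 add0r mul1r add0r.
  case: k => [|k] /=; first by rewrite !mul0r !oppr0 mul0r.
  have -> : v 1 0 ^ (- k%:Z) = v 1 0 ^ (- k.+1%:Z) * v 1 0.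
    by rewrite -[X in _ * X]expr1z -expfzDr //; congr (_ ^ _); lia.
  by ring.
(* [H] acts as [- 2 w d/dw + (t - 1)]. *)
- move=> k; apply: gs_funP => v v1; rewrite gs_funZ gs_monomial_act // gs_monomialE //.
  rewrite !lie_derive_coord /= !mxE /=.
  have -> : v 1 0 ^ (- k%:Z) = v 1 0 ^ (- k%:Z - 1) * v 1 0.
    by rewrite -[X in _ * X]expr1z -expfzDr // subrK.
  rewrite intrB; case: k => [|k] /=; first by ring.
  rewrite exprS; ring.
(* [F] acts as [w^2 d/dw - (t - 1) w], whose values vanish at [w = 0]. *)
- move=> k; rewrite gs_monomial_act // !lie_derive_coord /= !mxE /=.
  by rewrite !mulr0 !mul0r !addr0 oppr0 !mulr0 addr0.
Qed.

End GlobalSections.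

Theorem theorem6p3 (R : realType) (t : int) (ht : 1 <= t) :
  gmod_iso (global_sections (I_Uinf R[i] t)) (dual_verma ((t - 1)%:~R : R[i])).
Proof. exact: global_sections_I_Uinf. Qed.
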